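(* Let $H>0$, $0<h_0<H$, $c_1>1$, $\Omega=(0,1)\times(0,H)$, $\Omega_0=(0,1)\times(0,h_0)$, $\Omega_1=(0,1)\times(h_0,H)$, let $c=1$ on $\Omega_0$ and $c=c_1$ on $\Omega_1$, and let $A=-c\Delta$ with Dirichlet boundary conditions. Let $\omega=\omega_1\times(a,b)\subset\Omega$ be open and let $(v_{k_n,\ell_n})_{n\ge1}$ be a sequence of guided eigenfunctions of $A$. Write $\xi_0=\xi_0(k_n,\ell_n)$, $\xi_1'=\xi_1'(k_n,\ell_n)$. (1) If $\omega\subset\Omega_1$, then: (a) if $\xi_1'(k_n,\ell_n)\to\infty$, then as $n\to\infty$ $$\frac{\|v_{k_n,\ell_n}\|^2_{L^2(\omega)}}{\|v_{k_n,\ell_n}\|^2_{L^2(\Omega)}}\sim\frac{\mathrm{vol}(\omega_1)}{h_0}\;\frac{\sin^2(\xi_0h_0)}{1-\frac{\sin(2\xi_0h_0)}{2\xi_0h_0}}\;\frac{e^{-2\xi_1'(a-h_0)}}{\xi_1'};$$ (b) if $\sup_n\xi_1'(k_n,\ell_n)<\infty$, then $\displaystyle\inf_n\frac{\|v_{k_n,\ell_n}\|^2_{L^2(\omega)}}{\|v_{k_n,\ell_n}\|^2_{L^2(\Omega)}}>0$. (2) If $\omega\subset\Omega_0$, then $\displaystyle\inf_n\frac{\|v_{k_n,\ell_n}\|^2_{L^2(\omega)}}{\|v_{k_n,\ell_n}\|^2_{L^2(\Omega)}}>0$.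
   Context: $A=-c\Delta$ acts in $L^2(\Omega,c^{-1}dx)$ with domain $H^1_0(\Omega)\cap H^2(\Omega)$. For each integer $k\ge1$, $\lambda_{k,1}<\lambda_{k,2}<\cdots$ are the numbers $\lambda$ for which there is a nonzero $u_{k,\ell}\in H^2(0,H)$ with $u''+(\frac{\lambda}{c}-k^2\pi^2)u=0$, $u(0)=u(H)=0$; the eigenfunctions are $v_{k,\ell}(x)=a_{k,\ell}\sqrt2\sin(k\pi x_1)u_{k,\ell}(x_2)$, $a_{k,\ell}\neq0$ a normalizing constant. The eigenfunction $v_{k,\ell}$ (or eigenvalue $\lambda_{k,\ell}$) is called guided if $k^2\pi^2<\lambda_{k,\ell}<c_1k^2\pi^2$. For guided eigenvalues put $\xi_0(k,\ell)=(\lambda_{k,\ell}-k^2\pi^2)^{1/2}$ and $\xi_1'(k,\ell)=(k^2\pi^2-\lambda_{k,\ell}/c_1)^{1/2}$. Then $u_{k,\ell}(x_2)=\sin(\xi_0x_2)$ for $0<x_2<h_0$ and $u_{k,\ell}(x_2)=\frac{\sin(\xi_0h_0)}{\sinh(\xi_1'(H-h_0))}\sinh(\xi_1'(H-x_2))$ for $h_0<x_2<H$, with the dispersion relation $\frac{\tanh(\xi_1'(H-h_0))}{\xi_1'}=-\frac{\tan(\xi_0h_0)}{\xi_0}$. Sequences of guided eigenfunctions are without repetition, hence $k_n\to\infty$. Here $\omega_1\subset(0,1)$ is nonempty and open, $0\le a<b\le H$, and $\mathrm{vol}$ is Lebesgue measure. *)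

(* Defs.v *)
From HB Require Import structures.
From mathcomp Require Import all_boot all_order all_algebra.
From mathcomp Require Import all_classical all_reals all_analysis.
Import Order.TTheory GRing.Theory Num.Theory.
Import numFieldNormedType.Exports.

Set Implicit Arguments.
Unset Strict Implicit.
Unset Printing Implicit Defensive.

Local Open Scope classical_set_scope.
Local Open Scope ring_scope.

Definition strip {R : realType} (p q : R) : set (R * R) :=
  `]0, 1[%classic `*` `]p, q[%classic.

(* The coefficient c depends on x2 only; its value on the interface x2 = h0
   is irrelevant, since it only enters an almost-everywhere equation. *)
Definition coeff {R : realType} (h0 c1 x2 : R) : R :=
  if x2 < h0 then 1 else c1.

(* L^2(D) for D a subset of R (no weight). *)
Definition inL2 {R : realType} (D : set R) (f : R -> R) : Prop :=
  (f \_ D : R -> R) \in Lfun (@lebesgue_measure R) (2%:R)%:E.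

Definition test_function {R : realType} (H : R) (phi : R -> R) : Prop :=
  [/\ forall x, derivable phi x 1,
      continuous (derive1 phi) &
      closure [set x | phi x != 0] `<=` `]0, H[%classic].

(* g is the weak derivative of f on (0, H), tested against C^1_c(0, H) (for
   one-dimensional Sobolev spaces this is the same as testing against
   C^oo_c(0, H)). *)
Definition weak_derivative {R : realType} (H : R) (f g : R -> R) : Prop :=
  forall phi : R -> R, test_function H phi ->
    \int[@lebesgue_measure R]_(x in `]0%R, H[) (f x * derive1 phi x) =
    - \int[@lebesgue_measure R]_(x in `]0%R, H[) (g x * phi x).

(* u belongs to H^2(0, H), with u' = u1 and u'' = u2 (weak derivatives). *)
Definition sobolev2 {R : realType} (H : R) (u u1 u2 : R -> R) : Prop :=
  [/\ inL2 `]0, H[%classic u, inL2 `]0, H[%classic u1,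
      inL2 `]0, H[%classic u2,
      weak_derivative H u u1 & weak_derivative H u1 u2].

(* u is a nonzero element of H^2(0, H) such that
   u'' + (lambda / c - k^2 pi^2) u = 0 and u(0) = u(H) = 0.  The representative
   u is the continuous one, so that boundary values make sense pointwise. *)
Definition mode {R : realType} (H h0 c1 : R) (k : nat) (lambda : R)
    (u : R -> R) : Prop :=
  [/\ {within `[0, H], continuous u},
      (exists2 x, x \in `]0, H[ & u x != 0),
      u 0 = 0,
      u H = 0 &
      exists u1 u2 : R -> R, sobolev2 H u u1 u2 /\
        {ae @lebesgue_measure R, forall x, x \in `]0, H[ ->
          u2 x + (lambda / coeff h0 c1 x - k%:R ^+ 2 * pi ^+ 2) * u x = 0}].

(* For every k >= 1, (lambda k l)_{l >= 1} is the increasing enumeration of the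
   numbers admitting a mode.  The values at k = 0 or l = 0 are unconstrained. *)
Definition eigenvalue_enumeration {R : realType} (H h0 c1 : R)
    (lambda : nat -> nat -> R) : Prop :=
  forall k : nat, (0 < k)%N ->
    (forall l m : nat, (0 < l)%N -> (l < m)%N -> lambda k l < lambda k m) /\
    (forall x : R, (exists u : R -> R, mode H h0 c1 k x u) <->
                   (exists2 l : nat, (0 < l)%N & lambda k l = x)).

Definition eigenfunction {R : realType} (alpha : R) (k : nat) (u : R -> R)
    (x : R * R) : R :=
  alpha * Num.sqrt 2 * sin (k%:R * pi * x.1) * u x.2.

Definition guided {R : realType} (c1 : R) (k : nat) (lambda : R) : Prop :=
  k%:R ^+ 2 * pi ^+ 2 < lambda < c1 * (k%:R ^+ 2 * pi ^+ 2).

Definition xi0_of {R : realType} (k : nat) (lambda : R) : R :=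
  Num.sqrt (lambda - k%:R ^+ 2 * pi ^+ 2).

Definition xi1'_of {R : realType} (c1 : R) (k : nat) (lambda : R) : R :=
  Num.sqrt (k%:R ^+ 2 * pi ^+ 2 - lambda / c1).

(* Norm of L^2(D) with respect to plain (unweighted) Lebesgue measure. *)
Definition L2norm {R : realType} (D : set (R * R)) (v : R * R -> R) : R :=
  fine ('N[(@lebesgue_measure R \x @lebesgue_measure R)%E]_((2%:R)%:E)
          [EFin \o (v \_ D)]).

Definition vol {R : realType} (D : set R) : R := fine (lebesgue_measure D).

(* Main.v *)
Require Import Defs.
From HB Require Import structures.
From mathcomp Require Import all_boot all_order all_algebra.
From mathcomp Require Import all_classical all_reals all_analysis.
From mathcomp Require Import measurable_realfun ring lra.
Import Order.TTheory GRing.Theory Num.Theory.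
Import numFieldNormedType.Exports.

Local Open Scope classical_set_scope.
Local Open Scope ring_scope.

Set Implicit Arguments.
Unset Strict Implicit.
Unset Printing Implicit Defensive.

(** Write xi for xi_0 and eta for xi_1'.  By separation of variables the ratio of
    the two squared norms is the product of a horizontal factor
    2 int_omega1 sin^2 (k pi x) dx and a vertical factor
    int_a^b W^2 / int_0^H W^2, where W is the profile of the mode with amplitude
    1 in the lower layer (ratio_eq).

    The profile has to be extracted from the weak definition of a mode.  On a
    layer where the coefficient is constant, a weak solution is orthogonal to
    every continuous psi that is itself orthogonal to the two classical
    solutions, because such a psi is phi'' + kappa phi for a bump phi; a weighted
    orthogonal projection then identifies the weak solution with a classical one
    (weak_solution_oo).  One more bump, positive at the interface, matches the
    derivatives, which gives W and the dispersion relation (mode_profile).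

    Bounds from below.  The dispersion relation forces xi h0 > 1, so xi is bounded
    away from 0 and the integrals of sin^2 (xi x) over a fixed interval are
    bounded below (Rintegral_sin2_lb); the horizontal factor is treated by the
    same lemma.  As |W| <= 1, the total mass is at most H.  This settles a window
    in the lower layer.  In the upper layer, with eta bounded, the dispersion
    relation keeps sin (xi h0) away from 0 and the hyperbolic sine is comparable
    to a linear function (upper_layer_lb).

    Asymptotics.  When eta tends to infinity so does k, because eta <= k pi; the
    horizontal factor tends to vol omega1 by the Riemann-Lebesgue lemma, here a
    consequence of Bessel's inequality (cos_coefficient_cvg0).  The mass in the
    window is sin^2 (xi h0) exp (-2 eta (a - h0)) / (2 eta) times a factor that
    tends to 1 (layer_factor_cvg1), and the total mass is that of the lower layer
    up to a relative error O(1 / eta) (profile_ratio). *)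

(** * Integrals of continuous functions *)

Local Notation mu := (@lebesgue_measure _).

Lemma continuous_integrable_itv {R : realType} (p q : R) (f : R -> R) :
  continuous f -> mu.-integrable `[p, q] (EFin \o f).
Proof.
move=> cf; apply: continuous_compact_integrable; first exact: segment_compact.
exact: continuous_subspaceT.
Qed.
#[local] Hint Resolve continuous_integrable_itv : core.

Lemma is_derive_continuous {R : realType} (F f : R -> R) :
  (forall x : R, is_derive x 1 F (f x)) -> continuous F.
Proof.
move=> dF x; apply: differentiable_continuous; apply/derivable1_diffP.
exact: ex_derive.
Qed.

Lemma is_derive_derive1 {R : realType} (F f : R -> R) :
  (forall x : R, is_derive x 1 F (f x)) -> derive1 F = f.
Proof. by move=> dF; apply/funext => x; rewrite derive1E derive_val. Qed.

Lemma Rintegral_FTC {R : realType} (F f : R -> R) (p q : R) :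
  p <= q -> continuous f -> (forall x : R, is_derive x 1 F (f x)) ->
  \int[mu]_(x in `[p, q]) f x = F q - F p.
Proof.
move=> pq cf dF; have cF := is_derive_continuous dF.
move: pq; rewrite le_eqVlt => /predU1P[->|pq].
  by rewrite set_itv1 Rintegral_set1 subrr.
rewrite /Rintegral (@continuous_FTC2 _ f F p q)//.
- exact: continuous_subspaceT.
- split.
  + by move=> x _; exact: ex_derive.
  + by apply: cvg_at_right_filter; exact: cF.
  + by apply: cvg_at_left_filter; exact: cF.
- by move=> x _; rewrite (is_derive_derive1 dF).
Qed.

Lemma Rintegral_itv_split {R : realType} (p m q : R) (f : R -> R) :
  p <= m <= q -> continuous f ->
  \int[mu]_(x in `[p, q]) f x =
  \int[mu]_(x in `[p, m]) f x + \int[mu]_(x in `[m, q]) f x.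
Proof.
move=> /andP[pm mq] cf.
have i1 : mu.-integrable `[p, q] (EFin \o f) by exact: continuous_integrable_itv.
have i2 : mu.-integrable `[m, q] (EFin \o f) by exact: continuous_integrable_itv.
rewrite -(@Rintegral_itv_obnd_cbnd _ m); last first.
  by apply: integrableS i2 => //; apply: subset_itvr; rewrite bnd_simp.
rewrite -(@Rintegral_itvB _ f (BLeft p) (BRight q) m) ?bnd_simp//.
by rewrite addrC subrK.
Qed.

Lemma Rintegral_itv_oocc {R : realType} (p q : R) (f : R -> R) :
  mu.-integrable `[p, q] (EFin \o f) ->
  \int[mu]_(x in `]p, q[) f x = \int[mu]_(x in `[p, q]) f x.
Proof.
move=> i1; rewrite Rintegral_itv_bndo_bndc; last first.
  by apply: integrableS i1 => //; exact: subset_itv_oo_cc.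
rewrite Rintegral_itv_obnd_cbnd//.
by apply: integrableS i1 => //; exact: subset_itv_oc_cc.
Qed.

Lemma eq_Rintegral_itv {R : realType} (p q : R) (f g : R -> R) :
  (forall x, p <= x <= q -> f x = g x) ->
  \int[mu]_(x in `[p, q]) f x = \int[mu]_(x in `[p, q]) g x.
Proof.
by move=> fg; apply: eq_Rintegral => x /set_mem /=; rewrite in_itv/=; exact: fg.
Qed.

Lemma le_Rintegral_itv {R : realType} (p q : R) (f g : R -> R) :
  continuous f -> continuous g -> (forall x, p <= x <= q -> f x <= g x) ->
  \int[mu]_(x in `[p, q]) f x <= \int[mu]_(x in `[p, q]) g x.
Proof.
by move=> cf cg fg; apply: le_Rintegral => //; exact: continuous_integrable_itv.
Qed.

(** The running integral from p is nondecreasing and vanishes at q, so it is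
    identically zero on [p, q]; its derivative is f. *)
Lemma Rintegral_itv_eq0 {R : realType} (p q : R) (f : R -> R) :
  continuous f -> (forall x, 0 <= f x) ->
  \int[mu]_(x in `[p, q]) f x = 0 -> forall x, p < x < q -> f x = 0.
Proof.
move=> cf f0 If0 x /andP[px xq].
pose F y := \int[mu]_(t in `[p, y]) f t.
have F0 y : p < y < q -> F y = 0.
  move=> /andP[py yq].
  have Fy0 : 0 <= F y by exact: Rintegral_ge0.
  have := @Rintegral_itv_split _ p y q f; rewrite If0 (ltW py) (ltW yq).
  move=> /(_ isT cf) H0.
  have I0 : 0 <= \int[mu]_(x in `[y, q]) f x by exact: Rintegral_ge0.
  by move/esym/eqP : H0; rewrite paddr_eq0// => /andP[/eqP].
have [dF <-] := @continuous_FTC1_closed _ f p x q xq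
  (@continuous_integrable_itv _ _ _ _ cf) px (cf x).
rewrite derive1E.
have : is_derive x (1:R) F 0.
  apply: (@near_eq_is_derive _ _ _ (cst 0)).
  near=> y; rewrite F0//.
  have : y \in `]p, q[.
    by near: y; apply: near_in_itvoo; rewrite in_itv/= px xq.
  by rewrite in_itv.
by move=> ?; exact: derive_val.
Unshelve. all: by end_near. Qed.

(** The integral starts at minus infinity, so that it is differentiable at every
    point of the line, without a special role for the end p of the support. *)
Definition primitive {R : realType} (f : R -> R) (x : R) : R :=
  \int[mu]_(t in `]-oo, x]) f t.

Section primitive.
Context {R : realType} (f : R -> R) (p q : R).
Hypothesis cf : continuous f.
Hypothesis f0 : forall x, ~~ (p <= x <= q) -> f x = 0.

Let fE : f = f \_ `[p, q].
Proof.
apply/funext => x; rewrite patchE; case: ifPn => // /negP xpq.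
by apply: f0; apply/negP => xpq'; apply: xpq; rewrite inE/= in_itv.
Qed.

Lemma is_derive_primitive (x : R) : is_derive x 1 (primitive f) (f x).
Proof.
have ifT : mu.-integrable setT (EFin \o f).
  rewrite fE -restrict_EFin; apply/integrable_restrict => //=.
  by rewrite setTI; exact: continuous_integrable_itv.
have [] := @continuous_FTC1 R f -oo%O x (x + 1) _ _ _ (@cf x).
- by rewrite ltrDl.
- by apply: integrableS ifT.
- by rewrite ltNyr.
move=> d1 d2; apply: DeriveDef => //.
by rewrite -derive1E d2.
Qed.

Lemma primitive_left (x : R) : x < p -> primitive f x = 0.
Proof.
move=> xp; rewrite /primitive (@eq_Rintegral _ _ _ _ _ (cst 0)).
  by rewrite Rintegral_mkcond/= /Rintegral/= integral0_eq// => y _; rewrite patchE; case: ifP.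
move=> y /set_mem/=; rewrite in_itv/= => yx; apply: f0.
by rewrite negb_and -ltNge (le_lt_trans yx xp).
Qed.

Lemma primitive_right (x : R) : q < x ->
  primitive f x = \int[mu]_(t in `[p, q]) f t.
Proof.
move=> qx; rewrite /primitive fE.
rewrite Rintegral_mkcond [RHS]Rintegral_mkcond; congr Rintegral.
apply/funext => t; rewrite !patchE/= !mem_setE.
case: ifPn => //; case: ifPn => // tpq; rewrite in_itv/=.
rewrite in_itv/= in tpq; move/andP: tpq => [_ tq].
by rewrite (le_trans tq (ltW qx)).
Qed.

End primitive.

(** * Continuity and derivatives of composite expressions *)

Section continuous_lambda.
Context {T : topologicalType} {R : realType}.
Implicit Types f g : T -> R.

Lemma continuous_funD f g : continuous f -> continuous g -> continuous (fun x => f x + g x).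
Proof. by move=> cf cg x; apply: continuousD; [exact: cf|exact: cg]. Qed.

Lemma continuous_funN f : continuous f -> continuous (fun x => - f x).
Proof. by move=> cf x; apply: continuousN; exact: cf. Qed.

Lemma continuous_funM f g : continuous f -> continuous g -> continuous (fun x => f x * g x).
Proof. by move=> cf cg x; apply: continuousM; [exact: cf|exact: cg]. Qed.

Lemma continuous_funX f n : continuous f -> continuous (fun x => f x ^+ n).
Proof.
move=> cf; elim: n => [|n ih].
  by rewrite (_ : (fun _ => _) = cst 1); [exact: cst_continuous|apply/funext => x; rewrite expr0].
by under eq_fun do rewrite exprS; exact: continuous_funM.
Qed.

Lemma continuous_fun_comp f (h : R -> R) :
  continuous h -> continuous f -> continuous (fun x => h (f x)).
Proof. by move=> ch cf x; apply: continuous_comp; [exact: cf|exact: ch]. Qed.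

End continuous_lambda.

(** The syntactic match prevents unification from unfolding sin, cos or expR
    when the head symbol of the function is known. *)
Ltac continuity := lazymatch goal with
  | |- forall x, continuous_at x (fun _ => ?c) => exact: cst_continuous
  | |- forall x, continuous_at x (fun y => y) => by move=> ?; exact: cvg_id
  | |- forall x, continuous_at x (fun y => @?f y + @?g y) =>
      apply: (@continuous_funD _ _ f g); continuity
  | |- forall x, continuous_at x (fun y => @?f y * @?g y) =>
      apply: (@continuous_funM _ _ f g); continuity
  | |- forall x, continuous_at x (fun y => - @?f y) => apply: (@continuous_funN _ _ f); continuity
  | |- forall x, continuous_at x (fun y => @?f y ^+ ?n) =>
      apply: (@continuous_funX _ _ f n); continuity
  | |- forall x, continuous_at x (fun y => sin (@?f y)) =>
      apply: (@continuous_fun_comp _ _ f sin); [exact: continuous_sin|continuity]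
  | |- forall x, continuous_at x (fun y => cos (@?f y)) =>
      apply: (@continuous_fun_comp _ _ f cos); [exact: continuous_cos|continuity]
  | |- forall x, continuous_at x (fun y => expR (@?f y)) =>
      apply: (@continuous_fun_comp _ _ f expR); [exact: continuous_expR|continuity]
  | |- _ => try assumption
  end.

Section derive_lambda.
Context {R : realType}.
Implicit Types (f g : R -> R) (x a b : R).

Lemma is_derive_funD f g x a b : is_derive x 1 f a -> is_derive x 1 g b ->
  is_derive x 1 (fun y => f y + g y) (a + b).
Proof. by move=> df dg; exact: is_deriveD. Qed.

Lemma is_derive_funN f x a : is_derive x 1 f a -> is_derive x 1 (fun y => - f y) (- a).
Proof. by move=> df; exact: is_deriveN. Qed.

Lemma is_derive_funM f g x a b : is_derive x 1 f a -> is_derive x 1 g b ->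
  is_derive x 1 (fun y => f y * g y) (a * g x + f x * b).
Proof.
move=> df dg; apply: (is_derive_eq (is_deriveM df dg)).
by rewrite /GRing.scale/= addrC [a * _]mulrC.
Qed.

Lemma is_derive_fun_comp f g x a b : is_derive (g x) 1 f a -> is_derive x 1 g b ->
  is_derive x 1 (fun y => f (g y)) (a * b).
Proof. by move=> df dg; exact: is_derive1_comp. Qed.

Lemma is_derive_funZ f x (k a : R) : is_derive x 1 f a ->
  is_derive x 1 (fun y => k * f y) (k * a).
Proof.
move=> df; have := is_derive_funM (is_derive_cst k x (1 : R)) df.
by rewrite mul0r add0r.
Qed.

Lemma is_derive_funX f x a n : is_derive x 1 f a ->
  is_derive x 1 (fun y => f y ^+ n.+1) (n.+1%:R * f x ^+ n * a).
Proof.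
move=> df; elim: n => [|n ih].
  rewrite expr0 !mul1r (_ : (fun _ => _) = f)//.
rewrite (_ : (fun _ => _) = (fun y => f y * f y ^+ n.+1)); last first.
  by apply/funext => y; rewrite exprS.
apply: (is_derive_eq (is_derive_funM df ih)).
by rewrite -[n.+2%:R]natr1 exprS; ring.
Qed.

Lemma is_derive_affine x (k b : R) : is_derive x 1 (fun y => k * y + b) k.
Proof.
have := is_derive_funD (is_derive_funZ k (is_derive_id x (1 : R))) (is_derive_cst b x (1 : R)).
by rewrite mulr1 addr0.
Qed.

End derive_lambda.

Lemma is_derive_comp_scale {R : realType} (F f : R -> R) (x k : R) :
  is_derive (k * x) 1 F (f (k * x)) -> is_derive x 1 (fun y => F (k * y)) (k * f (k * x)).
Proof.
move=> dF; rewrite mulrC; apply: is_derive_fun_comp dF _.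
by have := is_derive_affine x k 0; under eq_fun do rewrite addr0.
Qed.

Definition C2_bump {R : realType} (p q : R) (phi phi1 phi2 : R -> R) : Prop :=
  [/\ forall x : R, is_derive x 1 phi (phi1 x), forall x : R, is_derive x 1 phi1 (phi2 x),
      continuous phi2 & forall x, ~~ (p <= x <= q) -> phi x = 0].

(** The complement of [p, q] is open, so f is constant near each of its points. *)
Lemma is_derive_vanish {R : realType} (p q : R) (f g : R -> R) :
  (forall x : R, is_derive x 1 f (g x)) -> (forall x, ~~ (p <= x <= q) -> f x = 0) ->
  forall x, ~~ (p <= x <= q) -> g x = 0.
Proof.
move=> df f0 x xpq; have dfx := df x.
have d0 : is_derive x 1 f 0; last first.
  by rewrite -(@derive_val _ _ _ _ _ _ _ dfx) (@derive_val _ _ _ _ _ _ _ d0).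
apply: (@near_eq_is_derive _ _ _ (cst 0)).
move: xpq; rewrite negb_and -!ltNge => /orP[xp|qx]; near=> y; rewrite f0// negb_and -!ltNge.
- by apply/orP; left; near: y; exact: lt_nbhsl.
- by apply/orP; right; near: y; exact: lt_nbhsr.
Unshelve. all: by end_near. Qed.

Lemma test_function_vanish {R : realType} (H p q : R) (f g : R -> R) :
  0 < p -> q < H -> (forall x : R, is_derive x 1 f (g x)) -> continuous g ->
  (forall x, ~~ (p <= x <= q) -> f x = 0) -> test_function H f.
Proof.
move=> p0 qH df cg f0; split.
- by move=> x; exact: ex_derive.
- by rewrite (is_derive_derive1 df).
- apply: (@subset_trans _ `[p, q]); last first.
    move=> x /=; rewrite !in_itv/= => /andP[px xq].
    by rewrite (lt_le_trans p0 px) (le_lt_trans xq qH).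
  have /closure_id -> : closed `[p, q]%classic by exact: itv_closed.
  apply: closureS => x /= fx0; rewrite in_itv/=.
  by apply: contra_neqT fx0 => /f0.
Qed.

(** * The weak form of the mode equation *)

Lemma inL2_measurable {R : realType} (D : set R) (f : R -> R) :
  measurable D -> inL2 D f -> measurable_fun D f.
Proof.
move=> mD; rewrite /inL2 /Lfun inE => /andP[]; rewrite inE => mf _.
exact/measurable_restrictT.
Qed.

Lemma C2_bump_test {R : realType} (H p q : R) (phi phi1 phi2 : R -> R) :
  0 < p -> q < H -> C2_bump p q phi phi1 phi2 ->
  test_function H phi /\ test_function H phi1.
Proof.
move=> p0 qH [d1 d2 c2 phi0]; have c1 := is_derive_continuous d2; split.
  exact: (test_function_vanish p0 qH d1).
apply: (test_function_vanish p0 qH d2 c2); exact: is_derive_vanish d1 phi0.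
Qed.

(** Two integrations by parts against a C2 bump eliminate the weak derivatives.
    The coefficient is constant on each layer, so the integral is split at h0. *)
Lemma mode_weak {R : realType} (H h0 c1 : R) k lambda (u U : R -> R) (p q : R)
    (phi phi1 phi2 : R -> R) :
  0 < h0 < H -> mode H h0 c1 k lambda u ->
  continuous U -> (forall x, 0 <= x <= H -> U x = u x) ->
  0 < p -> q < H -> C2_bump p q phi phi1 phi2 ->
  \int[mu]_(x in `[0, h0])
    (U x * (phi2 x + (lambda - k%:R ^+ 2 * pi ^+ 2) * phi x)) +
  \int[mu]_(x in `[h0, H])
    (U x * (phi2 x + (lambda / c1 - k%:R ^+ 2 * pi ^+ 2) * phi x)) = 0.
Proof.
move=> /andP[h00 h0H] [_ _ _ _ [u1 [u2 [[_ _ L2 w1 w2] ae2]]]] cU UE p0 qH bp.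
have [t0 t1] := C2_bump_test p0 qH bp.
have [d1 d2 c2 phi0] := bp.
have cphi := is_derive_continuous d1.
have H0 : 0 < H by exact: lt_trans h0H.
set q0 := lambda - _; set q1 := lambda / c1 - _.
pose Q x := if x < h0 then q0 else q1.
pose g x := - (Q x * (U x * phi x)).
have E1 : \int[mu]_(x in `]0, H[) (U x * phi2 x) =
          \int[mu]_(x in `]0, H[) (u2 x * phi x).
  have := w1 _ t1; have := w2 _ t0.
  rewrite (is_derive_derive1 d1) (is_derive_derive1 d2) => -> /=.
  rewrite opprK => <-; apply: eq_Rintegral => x /set_mem/=; rewrite in_itv/=.
  by move=> /andP[x0 xH]; rewrite UE// !ltW.
have cUphi : continuous (fun x => U x * phi x) by continuity.
have mg : measurable_fun setT g.
  apply/measurable_funN/measurable_funM; last exact: continuous_measurable_fun.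
  by apply: measurable_fun_ifT => //; exact: measurable_fun_ltr.
have E2 : \int[mu]_(x in `]0, H[) (u2 x * phi x) = \int[mu]_(x in `]0, H[) g x.
  rewrite /Rintegral; congr fine; apply: ae_eq_integral => //.
  - apply/measurable_EFinP/measurable_funM; first exact: inL2_measurable.
    by apply: measurable_funTS; exact: continuous_measurable_fun.
  - by apply/measurable_EFinP; exact: measurable_funTS.
  - move: ae2; apply: filterS; first exact: (ae_filter_ringOfSetsType mu).
    move=> x xE x01; have := xE x01.
    have : 0 < x < H by move: x01; rewrite /= in_itv.
    move=> /andP[x0 xH]; rewrite -UE ?ltW// => xE'.
    have -> : u2 x = - (Q x * U x).
      apply/eqP; rewrite -addr_eq0 -[X in _ == X]xE'; apply/eqP; congr (_ + _ * _).
      by rewrite /Q /coeff /q0 /q1; case: ifP; rewrite ?divr1.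
    by rewrite /g /=; congr (_%:E); ring.
have ig : mu.-integrable `[0, H] (EFin \o g).
  have cK : continuous (fun x => (`|q0| + `|q1|) * (U x * phi x)) by continuity.
  apply: le_integrable (@continuous_integrable_itv _ 0 H _ cK) => //.
    by apply/measurable_EFinP; exact: measurable_funTS.
  move=> x _ /=; rewrite lee_fin normrN !normrM ler_wpM2r//.
  rewrite [leRHS]ger0_norm ?addr_ge0//.
  by rewrite /Q; case: ifP => _; rewrite ?lerDl ?lerDr.
have E3 : \int[mu]_(x in `]0, H[) g x =
    \int[mu]_(x in `[0, h0]) - (q0 * (U x * phi x)) +
    \int[mu]_(x in `[h0, H]) - (q1 * (U x * phi x)).
  have i1 r : mu.-integrable `[0, h0] (EFin \o (fun x => - (r * (U x * phi x)))).
    by apply: continuous_integrable_itv; continuity.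
  have i2 r : mu.-integrable `[h0, H] (EFin \o (fun x => - (r * (U x * phi x)))).
    by apply: continuous_integrable_itv; continuity.
  rewrite (@itv_bndbnd_setU _ _ _ (BLeft h0)) ?bnd_simp ?ltW//.
  rewrite Rintegral_setU//=; first last.
  - apply/disj_setPS => x [/=]; rewrite !in_itv/= => /andP[_ xh] /andP[].
    by rewrite leNgt xh.
  - rewrite -itv_bndbnd_setU ?bnd_simp ?ltW//.
    by apply: integrableS ig => //; exact: subset_itv_oo_cc.
  congr (_ + _).
  - rewrite -Rintegral_itv_oocc//; apply: eq_Rintegral => x /set_mem/=.
    by rewrite in_itv/= => /andP[_ xh]; rewrite /g /Q xh.
  - rewrite -(@Rintegral_itv_bndo_bndc _ _ H); last first.
      by apply: integrableS (i2 q1) => //; exact: subset_itv_co_cc.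
    apply: eq_Rintegral => x /set_mem/=.
    by rewrite in_itv/= => /andP[xh _]; rewrite /g /Q ltNge xh.
have cUphi2 : continuous (fun x => U x * phi2 x) by continuity.
have E4 : \int[mu]_(x in `]0, H[) (U x * phi2 x) =
    \int[mu]_(x in `[0, h0]) (U x * phi2 x) + \int[mu]_(x in `[h0, H]) (U x * phi2 x).
  rewrite Rintegral_itv_oocc; last exact: continuous_integrable_itv.
  by rewrite (@Rintegral_itv_split _ 0 h0 H _ _ cUphi2)// !ltW.
have E5 r a b : \int[mu]_(x in `[a, b]) (U x * (phi2 x + r * phi x)) =
    \int[mu]_(x in `[a, b]) (U x * phi2 x) -
    \int[mu]_(x in `[a, b]) - (r * (U x * phi x)).
  rewrite -RintegralB//.
  - by apply: eq_Rintegral => x _; ring.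
  - exact: continuous_integrable_itv.
  - by apply: continuous_integrable_itv; continuity.
by rewrite !E5 addrACA -E4 -opprD -E3 E1 E2 subrr.
Qed.

(** * Weak solutions with a constant coefficient *)

Lemma Rintegral_itvD {R : realType} (p q : R) (f g : R -> R) :
  continuous f -> continuous g ->
  \int[mu]_(x in `[p, q]) (f x + g x) =
  \int[mu]_(x in `[p, q]) f x + \int[mu]_(x in `[p, q]) g x.
Proof. by move=> cf cg; rewrite RintegralD//; exact: continuous_integrable_itv. Qed.

Lemma Rintegral_itvZ {R : realType} (p q k : R) (f : R -> R) : continuous f ->
  \int[mu]_(x in `[p, q]) (k * f x) = k * \int[mu]_(x in `[p, q]) f x.
Proof. by move=> cf; rewrite RintegralZl//; exact: continuous_integrable_itv. Qed.

Lemma Rintegral_support {R : realType} (c d p q : R) (f : R -> R) :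
  c <= p -> q <= d -> (forall x, ~~ (p <= x <= q) -> f x = 0) ->
  \int[mu]_(x in `[c, d]) f x = \int[mu]_(x in `[p, q]) f x.
Proof.
move=> cp qd f0; rewrite Rintegral_mkcond [RHS]Rintegral_mkcond; congr Rintegral.
apply/funext => x; rewrite !patchE/= !mem_setE !in_itv/=.
case: (boolP (p <= x <= q)) => [/andP[px xq]|/f0 ->]; last by case: ifP.
by rewrite (le_trans cp px) (le_trans xq qd).
Qed.

Definition hat {R : realType} (p q x : R) : R := Num.max 0 ((x - p) * (q - x)).

Lemma hat_continuous {R : realType} (p q : R) : continuous (hat p q).
Proof.
have cm : continuous (fun y : R => (y - p) * (q - y)) by continuity.
exact: (max_fun_continuous (@cst_continuous _ _ (0 : R)) cm).
Qed.

Lemma hat_ge0 {R : realType} (p q x : R) : 0 <= hat p q x.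
Proof. by rewrite /hat le_max lexx. Qed.

Lemma hat_gt0 {R : realType} (p q x : R) : p < x < q -> 0 < hat p q x.
Proof. by move=> /andP[px xq]; rewrite /hat lt_max mulr_gt0 ?orbT// subr_gt0. Qed.

Lemma hat_eq0 {R : realType} (p q x : R) : p <= q -> ~~ (p <= x <= q) -> hat p q x = 0.
Proof.
move=> pq; rewrite negb_and -!ltNge /hat => /orP[xp|qx]; apply/max_idPl.
- by apply: mulr_le0_ge0; lra.
- by apply: mulr_ge0_le0; lra.
Qed.

Lemma hat_orthogonal {R : realType} (p q : R) (f : R -> R) : continuous f ->
  \int[mu]_(x in `[p, q]) (hat p q x * f x ^+ 2) = 0 ->
  forall x, p < x < q -> f x = 0.
Proof.
move=> cf I0 x xpq.
have ch := @hat_continuous R p q.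
have cw : continuous (fun x => hat p q x * f x ^+ 2) by continuity.
have /(_ p q I0 x xpq)/eqP := Rintegral_itv_eq0 cw (fun x => mulr_ge0 (hat_ge0 p q x) (sqr_ge0 _)).
by rewrite mulf_eq0 gt_eqF ?hat_gt0//= expf_eq0/= => /eqP.
Qed.

(** Two solutions of g'' + kappa g = 0 with Wronskian normalised to 1. *)
Definition fundamental_pair {R : realType} (kappa : R) (g1 g2 dg1 dg2 : R -> R) :=
  [/\ forall x : R, is_derive x 1 g1 (dg1 x) /\ is_derive x 1 g2 (dg2 x),
      forall x : R, is_derive x 1 dg1 (- kappa * g1 x) /\
                    is_derive x 1 dg2 (- kappa * g2 x) &
      forall x, dg1 x * g2 x - g1 x * dg2 x = 1].

Section fundamental_pair.
Context {R : realType} (kappa : R) (g1 g2 dg1 dg2 : R -> R).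
Hypothesis fp : fundamental_pair kappa g1 g2 dg1 dg2.

Let d1 (x : R) : is_derive x 1 g1 (dg1 x). Proof. by have [/(_ x)[]] := fp. Qed.
Let d2 (x : R) : is_derive x 1 g2 (dg2 x). Proof. by have [/(_ x)[]] := fp. Qed.
Let dd1 (x : R) : is_derive x 1 dg1 (- kappa * g1 x).
Proof. by have [_ /(_ x)[]] := fp. Qed.
Let dd2 (x : R) : is_derive x 1 dg2 (- kappa * g2 x).
Proof. by have [_ /(_ x)[]] := fp. Qed.
Let W x : dg1 x * g2 x - g1 x * dg2 x = 1. Proof. by have [_ _] := fp. Qed.
Let c1 : continuous g1. Proof. exact: is_derive_continuous d1. Qed.
Let c2 : continuous g2. Proof. exact: is_derive_continuous d2. Qed.

Lemma fundamental_pair_free (p q a b : R) : p < q ->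
  (forall x, p < x < q -> a * g1 x + b * g2 x = 0) -> a = 0 /\ b = 0.
Proof.
move=> pq ab0; pose x := (p + q) / 2.
have xpq : x \in `]p, q[ by exact: mid_in_itvoo.
have e0 : a * g1 x + b * g2 x = 0 by apply: ab0; rewrite in_itv in xpq.
have e1 : a * dg1 x + b * dg2 x = 0.
  have df : is_derive x 1 (fun y => a * g1 y + b * g2 y) (a * dg1 x + b * dg2 x).
    by apply: is_derive_funD; exact: is_derive_funZ.
  have d0 : is_derive x 1 (fun y => a * g1 y + b * g2 y) 0.
    apply: (@near_eq_is_derive _ _ _ (cst 0)); near=> y; rewrite ab0//.
    have : y \in `]p, q[ by near: y; exact: near_in_itvoo.
    by rewrite in_itv.
  by rewrite -(@derive_val _ _ _ _ _ _ _ df) (@derive_val _ _ _ _ _ _ _ d0).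
have Wx := W x; split.
- transitivity ((a * dg1 x + b * dg2 x) * g2 x - (a * g1 x + b * g2 x) * dg2 x).
    by rewrite -[LHS]mulr1 -Wx; ring.
  by rewrite e0 e1 !mul0r subr0.
- transitivity ((a * g1 x + b * g2 x) * dg1 x - (a * dg1 x + b * dg2 x) * g1 x).
    by rewrite -[LHS]mulr1 -Wx; ring.
  by rewrite e0 e1 !mul0r subr0.
Unshelve. all: by end_near. Qed.

(** Variation of parameters: phi = g1 P2 - g2 P1, where Pi is the primitive of
    psi gi, solves phi'' + kappa phi = psi and vanishes to the left of p.  The
    two orthogonality relations make P1 and P2 vanish to the right of q. *)
Lemma bump_of_orthogonal (p q : R) (psi : R -> R) :
  continuous psi -> (forall x, ~~ (p <= x <= q) -> psi x = 0) ->
  \int[mu]_(x in `[p, q]) (psi x * g1 x) = 0 ->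
  \int[mu]_(x in `[p, q]) (psi x * g2 x) = 0 ->
  exists phi phi1 phi2, C2_bump p q phi phi1 phi2 /\
    forall x, phi2 x + kappa * phi x = psi x.
Proof.
move=> cpsi psi0 o1 o2.
pose P1 := primitive (fun x => psi x * g1 x).
pose P2 := primitive (fun x => psi x * g2 x).
have v1 x : ~~ (p <= x <= q) -> psi x * g1 x = 0 by move=> /psi0 ->; rewrite mul0r.
have v2 x : ~~ (p <= x <= q) -> psi x * g2 x = 0 by move=> /psi0 ->; rewrite mul0r.
have cp1 : continuous (fun x => psi x * g1 x) by continuity.
have cp2 : continuous (fun x => psi x * g2 x) by continuity.
have dP1 (x : R) : is_derive x 1 P1 (psi x * g1 x) := is_derive_primitive cp1 v1 x.
have dP2 (x : R) : is_derive x 1 P2 (psi x * g2 x) := is_derive_primitive cp2 v2 x.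
have P10 x : ~~ (p <= x <= q) -> P1 x = 0.
  rewrite negb_and -!ltNge => /orP[xp|qx]; first by rewrite /P1 (primitive_left v1).
  by rewrite /P1 (primitive_right v1)// o1.
have P20 x : ~~ (p <= x <= q) -> P2 x = 0.
  rewrite negb_and -!ltNge => /orP[xp|qx]; first by rewrite /P2 (primitive_left v2).
  by rewrite /P2 (primitive_right v2)// o2.
exists (fun x => g1 x * P2 x + - (g2 x * P1 x)).
exists (fun x => dg1 x * P2 x + - (dg2 x * P1 x)).
exists (fun x => psi x - kappa * (g1 x * P2 x - g2 x * P1 x)).
have cP1 : continuous P1 := is_derive_continuous dP1.
have cP2 : continuous P2 := is_derive_continuous dP2.
split; last by move=> x; ring.
split.
- move=> x; apply: is_derive_eq.
    by apply: is_derive_funD; [exact: is_derive_funM|apply: is_derive_funN; exact: is_derive_funM].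
  ring.
- move=> x; apply: is_derive_eq.
    by apply: is_derive_funD; [exact: is_derive_funM|apply: is_derive_funN; exact: is_derive_funM].
  by rewrite -[X in _ = X - _]mulr1 -(W x); ring.
- by continuity.
- by move=> x xpq; rewrite P10// P20// !mulr0 oppr0 addr0.
Qed.

(** A replacement for regularity theory.  Let f be U minus its orthogonal
    projection on the span of g1 and g2, for the scalar product with weight hat.
    Then hat f is orthogonal to g1 and g2, hence of the form phi'' + kappa phi
    with phi a bump, and the weak equation makes it orthogonal to U as well.
    So f is orthogonal to itself, and f = 0. *)
Lemma weak_solution_oo (c d p q : R) (U : R -> R) :
  c <= p -> p < q -> q <= d -> continuous U ->
  (forall phi phi1 phi2, C2_bump p q phi phi1 phi2 ->
    \int[mu]_(x in `[c, d]) (U x * (phi2 x + kappa * phi x)) = 0) ->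
  exists A B, forall x, p < x < q -> U x = A * g1 x + B * g2 x.
Proof.
move=> cp pq qd cU weak.
have ch := @hat_continuous R p q.
pose G (f g : R -> R) := \int[mu]_(x in `[p, q]) (hat p q x * (f x * g x)).
have GD (f g h : R -> R) : continuous f -> continuous g -> continuous h -> forall a b,
    G (fun x => a * f x + b * g x) h = a * G f h + b * G g h.
  move=> cf cg chh a b; rewrite /G -Rintegral_itvZ; last by continuity.
  rewrite -Rintegral_itvZ; last by continuity.
  rewrite -Rintegral_itvD; [|by continuity|by continuity].
  by apply: eq_Rintegral_itv => x _; ring.
have GC (f g : R -> R) : G f g = G g f by apply: eq_Rintegral_itv => x _; rewrite (mulrC (f x)).
have Gsq (f : R -> R) : continuous f -> G f f = 0 -> forall x, p < x < q -> f x = 0.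
  by move=> cf Gf; exact: hat_orthogonal.
set a11 := G g1 g1; set a12 := G g1 g2; set a22 := G g2 g2.
have a22N0 : a22 != 0.
  apply/eqP => a0; have g20 := Gsq _ c2 a0.
  have [_] : (0 : R) = 0 /\ (1 : R) = 0.
    by apply: (fundamental_pair_free pq) => x /g20 ->; rewrite mul0r mulr0 addr0.
  by move/eqP; rewrite oner_eq0.
pose D := a11 * a22 - a12 ^+ 2.
(* If the Gram determinant vanished, a22 g1 - a12 g2 would have norm zero. *)
have DN0 : D != 0.
  apply/eqP => D0.
  have : G (fun x => a22 * g1 x + - a12 * g2 x) (fun x => a22 * g1 x + - a12 * g2 x) = 0.
    rewrite GD//; last by continuity.
    rewrite GC [in X in _ + X]GC !GD// -/a11 -/a22 [G g2 g1]GC -/a12.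
    by transitivity (a22 * D); [rewrite /D; ring|rewrite D0 mulr0].
  move=> /Gsq H0; have /H0 H1 : continuous (fun x => a22 * g1 x + - a12 * g2 x) by continuity.
  by have [/eqP] := fundamental_pair_free pq H1; rewrite (negbTE a22N0).
set b1 := G U g1; set b2 := G U g2.
(* Cramer's rule for the coefficients of the projection. *)
pose A := (b1 * a22 - b2 * a12) / D.
pose B := (b2 * a11 - b1 * a12) / D.
pose f x := 1 * U x + -1 * (A * g1 x + B * g2 x).
have cAB : continuous (fun x => A * g1 x + B * g2 x) by continuity.
have cf : continuous f by rewrite /f; continuity.
have f1 : G f g1 = 0.
  rewrite /f GD// GD// -/b1 -/a11 [G g2 g1]GC -/a12 /A /B.
  by rewrite /D in DN0 *; field.
have f2 : G f g2 = 0.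
  rewrite /f GD// GD// -/b2 -/a12 -/a22 /A /B.
  by rewrite /D in DN0 *; field.
have fU : G f U = 0.
  have [||||phi [phi1 [phi2 [bp phiE]]]] :=
      @bump_of_orthogonal p q (fun x => hat p q x * f x).
  - by continuity.
  - by move=> x xpq; rewrite hat_eq0 ?mul0r// ltW.
  - by rewrite -[RHS]f1; apply: eq_Rintegral_itv => x _; rewrite mulrA.
  - by rewrite -[RHS]f2; apply: eq_Rintegral_itv => x _; rewrite mulrA.
  rewrite -[RHS](weak _ _ _ bp) (@Rintegral_support _ c d p q)//.
    by apply: eq_Rintegral_itv => x _; rewrite phiE; ring.
  by move=> x xpq; rewrite phiE hat_eq0 ?mul0r ?mulr0// ltW.
have ff : G f f = 0.
  have := GD U _ f cU cAB cf 1 (-1).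
  rewrite (GD g1 g2 f c1 c2 cf A B) (GC U) fU (GC g1) f1 (GC g2) f2 !mulr0 addr0 mulr0 addr0 => h.
  exact: h.
exists A, B => x xpq.
have := Gsq _ cf ff _ xpq; rewrite /f mul1r mulN1r => /eqP.
by rewrite subr_eq0 => /eqP.
Qed.

(** The coefficients found on a fixed interval [p0, q0] are those of every larger
    interval, because g1 and g2 are independent on [p0, q0]; continuity then
    gives the two end points. *)
Lemma weak_solution_cc (c d : R) (U : R -> R) :
  c < d -> continuous U ->
  (forall p q phi phi1 phi2, c < p -> q < d -> C2_bump p q phi phi1 phi2 ->
    \int[mu]_(x in `[c, d]) (U x * (phi2 x + kappa * phi x)) = 0) ->
  exists A B, forall x, c <= x <= d -> U x = A * g1 x + B * g2 x.
Proof.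
move=> cd cU weak.
have loc p q : c < p -> p < q -> q < d ->
    exists A B, forall x, p < x < q -> U x = A * g1 x + B * g2 x.
  move=> cp pq qd; apply: (@weak_solution_oo c d) => //; try exact: ltW.
  by move=> phi phi1 phi2; exact: weak.
pose p0 := c + (d - c) / 3; pose q0 := c + (d - c) * 2 / 3.
have cp0 : c < p0 by rewrite /p0; lra.
have pq0 : p0 < q0 by rewrite /p0 /q0; lra.
have qd0 : q0 < d by rewrite /q0; lra.
have [A [B AB]] := loc _ _ cp0 pq0 qd0.
exists A, B.
have oo x : c < x < d -> U x = A * g1 x + B * g2 x.
  move=> /andP[cx xd].
  pose p := (c + Num.min x p0) / 2; pose q := (d + Num.max x q0) / 2.
  have cm : c < Num.min x p0 by rewrite lt_min cx.
  have md : Num.max x q0 < d by rewrite gt_max xd.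
  have [m1 m2] : Num.min x p0 <= x /\ Num.min x p0 <= p0 by split; rewrite ge_min lexx ?orbT.
  have [m3 m4] : x <= Num.max x q0 /\ q0 <= Num.max x q0 by split; rewrite le_max lexx ?orbT.
  have cp : c < p by rewrite /p; lra.
  have pm : p < Num.min x p0 by rewrite /p; lra.
  have mq : Num.max x q0 < q by rewrite /q; lra.
  have qd : q < d by rewrite /q; lra.
  have [A' [B' AB']] := loc p q cp ltac:(lra) qd.
  have [/eqP + /eqP] : A' - A = 0 /\ B' - B = 0.
    apply: (fundamental_pair_free pq0) => y /andP[py yq].
    have e1 := AB y ltac:(lra); have e2 := AB' y ltac:(lra).
    by rewrite !mulrBl addrACA -opprD -e1 -e2 subrr.
  rewrite !subr_eq0 => /eqP <- /eqP <-; apply: AB'; lra.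
pose f x := U x - (A * g1 x + B * g2 x).
have cf : continuous f by rewrite /f; continuity.
have f0 : `]c, d[%classic `<=` f @^-1` [set 0].
  by move=> x /=; rewrite in_itv/= /f => /oo ->; rewrite subrr.
have : closure `]c, d[%classic `<=` f @^-1` [set 0].
  have /closure_id -> : closed (f @^-1` [set 0]).
    by apply: preimage_closed => [x _|]; [exact: cf|exact: closed_eq].
  exact: closureS.
have e1 : (c + d) / 2 - (d - c) / 2 = c by field.
have e2 : (c + d) / 2 + (d - c) / 2 = d by field.
have -> : `]c, d[%classic = ball ((c + d) / 2) ((d - c) / 2).
  by rewrite ball_itv e1 e2.
rewrite closure_ballE closed_ballE; last by lra.
move=> H0 x /andP[cx xd]; have /H0 /= : closed_ball_ Num.norm ((c + d) / 2) ((d - c) / 2) x.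
  by rewrite /closed_ball_ /= ler_norml; apply/andP; split; lra.
by rewrite /f => /eqP; rewrite subr_eq0 => /eqP.
Qed.

End fundamental_pair.

(** * An explicit bump and the hyperbolic functions *)

(** At 0 the difference quotient is max(0, t)^(n+1), which is continuous. *)
Lemma is_derive_maxX {R : realType} (n : nat) (x : R) :
  is_derive x 1 (fun t : R => Num.max 0 t ^+ n.+2) (n.+2%:R * Num.max 0 x ^+ n.+1).
Proof.
have [x0|x0|->] := ltgtP x 0.
- rewrite exprS mul0r mulr0.
  apply: (@near_eq_is_derive _ _ _ (cst 0)); near=> t.
  rewrite max_l ?exprS ?mul0r//; apply/ltW; near: t; exact: lt_nbhsl.
- apply: (@near_eq_is_derive _ _ _ (fun t : R => t ^+ n.+2)); last first.
    by have := is_derive_funX n.+1 (is_derive_id x (1 : R)); rewrite mulr1.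
  by near=> t; rewrite max_r//; apply/ltW; near: t; exact: lt_nbhsr.
- rewrite exprS mul0r mulr0.
  have cm : continuous (fun t : R => Num.max 0 t).
    apply: (max_fun_continuous (@cst_continuous _ _ (0 : R))).
    by move=> ?; exact: cvg_id.
  apply/is_derive1_caratheodory; exists (fun t => Num.max 0 t ^+ n.+1); split.
  + move=> z; rewrite maxxx [0 ^+ n.+2]exprS mul0r !subr0 [LHS]exprS [RHS]mulrC.
    by case: (leP 0 z) => // _; rewrite [0 ^+ _]exprS !mul0r mulr0.
  + have cX : continuous (fun t : R => Num.max 0 t ^+ n.+1) by apply: continuous_funX.
    exact: cX.
  + by rewrite maxxx exprS mul0r.
Unshelve. all: by end_near. Qed.

Lemma C2_bump_exists {R : realType} (p q : R) : p < q ->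
  exists phi phi1 phi2, C2_bump p q phi phi1 phi2 /\
    forall x, p < x < q -> 0 < phi x.
Proof.
move=> pq; pose t (x : R) := (x + - p) * (q + - x); pose t1 (x : R) := p + q + - (2 * x).
have dt (x : R) : is_derive x 1 t (t1 x).
  have e1 : is_derive x 1 (fun y : R => y + - p) 1.
    by have := is_derive_funD (is_derive_id x (1 : R)) (is_derive_cst (- p) x (1 : R)); rewrite addr0.
  have e2 : is_derive x 1 (fun y : R => q + - y) (-1).
    by have := is_derive_funD (is_derive_cst q x (1 : R)) (is_derive_funN (is_derive_id x (1 : R))); rewrite add0r.
  by apply: (is_derive_eq (is_derive_funM e1 e2)); rewrite /t1; ring.
have dt1 (x : R) : is_derive x 1 t1 (-2).
  have := is_derive_funD (is_derive_cst (p + q) x (1 : R)) (is_derive_funN (is_derive_funZ 2 (is_derive_id x (1 : R)))).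
  by rewrite add0r mulr1.
have hE x : hat p q x = Num.max 0 (t x) by [].
have dX n (x : R) : is_derive x 1 (fun y => hat p q y ^+ n.+2) (n.+2%:R * hat p q x ^+ n.+1 * t1 x).
  exact: is_derive_fun_comp (@is_derive_maxX R n (t x)) (dt x).
exists (fun x => hat p q x ^+ 3), (fun x => 3 * hat p q x ^+ 2 * t1 x).
exists (fun x => 3 * (2 * hat p q x * t1 x) * t1 x + 3 * hat p q x ^+ 2 * (-2)).
have ch := @hat_continuous R p q; have ct1 : continuous t1 := is_derive_continuous dt1.
split; last by move=> x xpq; rewrite exprn_gt0// hat_gt0.
split.
- exact: dX.
- move=> x; apply: (is_derive_eq (is_derive_funM (is_derive_funZ 3 (dX 0%N x)) (dt1 x))).
  by rewrite expr1; ring.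
- by continuity.
- by move=> x xpq; rewrite hat_eq0 ?expr0n //; exact: ltW.
Qed.

Definition sinh {R : realType} (x : R) : R := (expR x - expR (- x)) / 2.
Definition cosh {R : realType} (x : R) : R := (expR x + expR (- x)) / 2.

Lemma cosh2_sinh2 {R : realType} (x : R) : cosh x ^+ 2 - sinh x ^+ 2 = 1.
Proof. by rewrite -[RHS](expRxMexpNx_1 x) /cosh /sinh; field. Qed.

Lemma sinh0 {R : realType} : sinh (0 : R) = 0.
Proof. by rewrite /sinh oppr0 subrr mul0r. Qed.

Lemma cosh0 {R : realType} : cosh (0 : R) = 1.
Proof. by rewrite /cosh oppr0 expR0; field. Qed.

Lemma cosh_gt0 {R : realType} (x : R) : 0 < cosh x.
Proof. by rewrite /cosh divr_gt0 ?addr_gt0 ?expR_gt0. Qed.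

Lemma sinh_gt0 {R : realType} (x : R) : 0 < x -> 0 < sinh x.
Proof. by move=> x0; rewrite /sinh divr_gt0// subr_gt0 ltr_expR; lra. Qed.

Lemma sinh_ge0 {R : realType} (x : R) : 0 <= x -> 0 <= sinh x.
Proof. by rewrite le_eqVlt => /predU1P[<-|/sinh_gt0/ltW//]; rewrite sinh0. Qed.

Lemma is_derive_expRN {R : realType} (x : R) :
  is_derive x 1 (fun y : R => expR (- y)) (- expR (- x)).
Proof.
apply: (is_derive_eq (is_derive_fun_comp (is_derive_expR (- x)) (is_derive_funN (is_derive_id x (1 : R))))).
by rewrite mulrN1.
Qed.

Lemma is_derive_sinh {R : realType} (x : R) : is_derive x 1 sinh (cosh x).
Proof.
have := is_derive_funZ 2^-1 (is_derive_funD (is_derive_expR x) (is_derive_funN (is_derive_expRN x))).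
rewrite opprK mulrC; congr is_derive; apply/funext => y.
by rewrite mulrC.
Qed.

Lemma is_derive_cosh {R : realType} (x : R) : is_derive x 1 cosh (sinh x).
Proof.
have := is_derive_funZ 2^-1 (is_derive_funD (is_derive_expR x) (is_derive_expRN x)).
rewrite mulrC; congr is_derive; apply/funext => y.
by rewrite mulrC.
Qed.

Lemma sinh_continuous {R : realType} : continuous (@sinh R).
Proof. exact: is_derive_continuous is_derive_sinh. Qed.

Lemma cosh_continuous {R : realType} : continuous (@cosh R).
Proof. exact: is_derive_continuous is_derive_cosh. Qed.

(** * The profile of a mode *)

(** A mode is arbitrary off [0, H]; composing it with the retraction of the line
    onto [0, H] gives a representative that is continuous everywhere. *)
Lemma extend_continuous {R : realType} (H : R) (u : R -> R) :
  0 <= H -> {within `[0, H], continuous u} ->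
  exists2 U : R -> R, continuous U & forall x, 0 <= x <= H -> U x = u x.
Proof.
move=> H0 cu; pose cl (x : R) := Num.max 0 (Num.min x H).
exists (u \o cl); last first.
  by move=> x /andP[x0 xH]; rewrite /cl/= min_l// max_r.
have ccl : continuous cl.
  apply: (max_fun_continuous (@cst_continuous _ _ (0 : R))).
  apply: (@min_fun_continuous _ _ _ id (cst H)).
    by move=> ?; exact: cvg_id.
  exact: cst_continuous.
have clP x : `[0, H]%classic (cl x).
  by rewrite /= in_itv/= /cl le_max lexx/= ge_max H0 ge_min lexx orbT.
move=> x B uB.
have := (subspace_continuousP _ _).1 cu _ (clP x) _ uB.
move=> /(ccl x); apply: (@filterS _ (nbhs x)) => y; apply; exact: clP.
Qed.

Lemma fundamental_pair_trig {R : realType} (xi : R) : 0 < xi ->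
  fundamental_pair (xi ^+ 2) (fun x => xi^-1 * sin (xi * x)) (fun x => cos (xi * x))
    (fun x => cos (xi * x)) (fun x => xi * - sin (xi * x)).
Proof.
move=> xi0.
have ds (x : R) : is_derive x 1 (fun y => sin (xi * y)) (xi * cos (xi * x)).
  exact: is_derive_comp_scale (is_derive_sin (xi * x)).
have dc (x : R) : is_derive x 1 (fun y => cos (xi * y)) (xi * - sin (xi * x)).
  exact: (@is_derive_comp_scale _ cos (fun y => - sin y) x xi (is_derive_cos (xi * x))).
split=> x.
- split; last exact: dc.
  by apply: (is_derive_eq (is_derive_funZ xi^-1 (ds x))); rewrite mulKf// gt_eqF.
- split; first by apply: (is_derive_eq (dc x)); field; rewrite gt_eqF.
  by apply: (is_derive_eq (is_derive_funZ xi (is_derive_funN (ds x)))); ring.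
- by rewrite -[RHS](cos2Dsin2 (xi * x)); field; rewrite gt_eqF.
Qed.

Lemma fundamental_pair_hyperbolic {R : realType} (xi H : R) : 0 < xi ->
  fundamental_pair (- xi ^+ 2)
    (fun x => xi^-1 * sinh (xi * (H - x))) (fun x => - cosh (xi * (H - x)))
    (fun x => - cosh (xi * (H - x))) (fun x => xi * sinh (xi * (H - x))).
Proof.
move=> xi0.
have dl (x : R) : is_derive x 1 (fun y => xi * (H - y)) (- xi).
  have := is_derive_funZ xi (is_derive_funD (is_derive_cst H x (1 : R)) (is_derive_funN (is_derive_id x (1 : R)))).
  by rewrite add0r mulrN1.
have ds (x : R) : is_derive x 1 (fun y => sinh (xi * (H - y))) (cosh (xi * (H - x)) * - xi).
  exact: (@is_derive_fun_comp _ sinh (fun y => xi * (H - y)) _ _ _ (is_derive_sinh _) (dl x)).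
have dc (x : R) : is_derive x 1 (fun y => cosh (xi * (H - y))) (sinh (xi * (H - x)) * - xi).
  exact: (@is_derive_fun_comp _ cosh (fun y => xi * (H - y)) _ _ _ (is_derive_cosh _) (dl x)).
split=> x.
- split; last by apply: (is_derive_eq (is_derive_funN (dc x))); ring.
  by apply: (is_derive_eq (is_derive_funZ xi^-1 (ds x))); field; rewrite gt_eqF.
- split; first by apply: (is_derive_eq (is_derive_funN (dc x))); field; rewrite gt_eqF.
  by apply: (is_derive_eq (is_derive_funZ xi (ds x))); ring.
- by rewrite -[RHS](cosh2_sinh2 (xi * (H - x))); field; rewrite gt_eqF.
Qed.

(** Lagrange's identity: G phi' - G' phi is a primitive of the integrand. *)
Lemma Rintegral_lagrange {R : realType} (a b kappa : R) (G dG phi phi1 phi2 : R -> R) :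
  a <= b -> (forall x : R, is_derive x 1 G (dG x)) ->
  (forall x : R, is_derive x 1 dG (- kappa * G x)) ->
  (forall x : R, is_derive x 1 phi (phi1 x)) ->
  (forall x : R, is_derive x 1 phi1 (phi2 x)) -> continuous phi2 ->
  \int[mu]_(x in `[a, b]) (G x * (phi2 x + kappa * phi x)) =
  (G b * phi1 b - dG b * phi b) - (G a * phi1 a - dG a * phi a).
Proof.
move=> ab dG1 dG2 d1 d2 c2.
have cG := is_derive_continuous dG1; have cphi := is_derive_continuous d1.
apply: (@Rintegral_FTC _ (fun x => G x * phi1 x - dG x * phi x)) => //; first by continuity.
move=> x; apply: (is_derive_eq (is_derive_funD (is_derive_funM (dG1 x) (d2 x)) (is_derive_funN (is_derive_funM (dG2 x) (d1 x))))).
ring.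
Qed.

(** The dispersion relation of the two layers without denominators, with eta
    for xi_1'. *)
Definition dispersion {R : realType} (H h0 xi eta : R) : Prop :=
  xi * cos (xi * h0) * sinh (eta * (H - h0)) =
    - (eta * cosh (eta * (H - h0)) * sin (xi * h0)).

(** On each layer the mode is a weak solution with constant coefficient, and the
    boundary conditions leave one free constant per layer.  Continuity at h0
    relates the constants; testing against a single bump that is positive at h0
    shows that the derivatives match too, which is the dispersion relation. *)
Lemma mode_profile {R : realType} (H h0 c1 : R) k lambda (u : R -> R) (xi eta : R) :
  0 < h0 < H -> mode H h0 c1 k lambda u -> 0 < xi -> 0 < eta ->
  lambda - k%:R ^+ 2 * pi ^+ 2 = xi ^+ 2 ->
  lambda / c1 - k%:R ^+ 2 * pi ^+ 2 = - eta ^+ 2 ->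
  dispersion H h0 xi eta /\
  exists2 C : R, C != 0 &
    (forall x, 0 <= x <= h0 -> u x = C * sin (xi * x)) /\
    (forall x, h0 <= x <= H -> u x =
       C * (sin (xi * h0) / sinh (eta * (H - h0)) * sinh (eta * (H - x)))).
Proof.
move=> h0H um xi0 eta0 q0E q1E.
have [cu [x0 x0H ux0] u0 uH _] := um.
have /andP[h00 hH] := h0H; have H0 : 0 < H := lt_trans h00 hH.
have [U cU UE] := extend_continuous (ltW H0) cu.
have weak p q phi phi1 phi2 : 0 < p -> q < H -> C2_bump p q phi phi1 phi2 ->
    \int[mu]_(x in `[0, h0]) (U x * (phi2 x + xi ^+ 2 * phi x)) +
    \int[mu]_(x in `[h0, H]) (U x * (phi2 x + - eta ^+ 2 * phi x)) = 0.
  by rewrite -q0E -q1E => p0 qH; exact: mode_weak h0H um cU UE p0 qH.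
have fp0 := fundamental_pair_trig xi0.
have fp1 := fundamental_pair_hyperbolic H eta0.
(* A bump supported in one layer does not see the other one. *)
have out0 a b kappa p q phi phi1 phi2 : C2_bump p q phi phi1 phi2 -> q < a \/ b < p ->
    \int[mu]_(x in `[a, b]) (U x * (phi2 x + kappa * phi x)) = 0.
  move=> [d1 d2 c2 phi0] out.
  have phi10 := is_derive_vanish d1 phi0; have phi20 := is_derive_vanish d2 phi10.
  transitivity (\int[mu]_(x in `[a, b]) (0 : R)); last first.
    by rewrite Rintegral_cst// mul0r.
  apply: eq_Rintegral_itv => x /andP[ax xb].
  have xpq : ~~ (p <= x <= q).
    by rewrite negb_and -!ltNge; case: out => h; lra.
  by rewrite phi0// phi20// mulr0 addr0 mulr0.
have [A [B UAB]] : exists A B, forall x, 0 <= x <= h0 ->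
    U x = A * (xi^-1 * sin (xi * x)) + B * cos (xi * x).
  apply: (weak_solution_cc fp0) => // p q phi phi1 phi2 p0 qh bp.
  have := weak p q phi phi1 phi2 p0 (lt_trans qh hH) bp.
  by rewrite (out0 h0 H _ _ _ _ _ _ bp) ?addr0//; left.
have [E [F UEF]] : exists A B, forall x, h0 <= x <= H ->
    U x = A * (eta^-1 * sinh (eta * (H - x))) + B * - cosh (eta * (H - x)).
  apply: (weak_solution_cc fp1) => // p q phi phi1 phi2 hp qH bp.
  have := weak p q phi phi1 phi2 (lt_trans h00 hp) qH bp.
  by rewrite (out0 0 h0 _ _ _ _ _ _ bp) ?add0r//; right.
have B0 : B = 0.
  have := UAB 0; rewrite lexx (ltW h00) UE ?lexx ?(ltW H0)// u0.
  by rewrite mulr0 sin0 cos0 !mulr0 add0r mulr1 => /(_ isT).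
have F0 : F = 0.
  have := UEF H; rewrite lexx (ltW hH) UE ?lexx ?(ltW H0)// uH.
  rewrite subrr mulr0 sinh0 cosh0 !mulr0 add0r => /(_ isT) /eqP.
  by rewrite eq_sym mulrN1 oppr_eq0 => /eqP.
rewrite B0 in UAB; rewrite F0 in UEF; clear B0 F0 B F.
set L := H - h0.
pose C := A / xi; pose E' := E / eta.
have uC x : 0 <= x <= h0 -> u x = C * sin (xi * x).
  move=> /andP[x0' xh]; rewrite -UE ?x0' ?(le_trans xh (ltW hH))//.
  by rewrite UAB ?x0'// mul0r addr0 mulrA.
have uE x : h0 <= x <= H -> u x = E' * sinh (eta * (H - x)).
  move=> /andP[hx xH]; rewrite -UE ?xH ?(le_trans (ltW h00) hx)//.
  by rewrite UEF ?hx// mul0r addr0 mulrA.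
have eq1 : C * sin (xi * h0) = E' * sinh (eta * L).
  by rewrite -uC ?lexx ?(ltW h00)// uE// lexx ltW.
have eq2 : C * (xi * cos (xi * h0)) = - (E' * (eta * cosh (eta * L))).
  have [phi [phi1 [phi2 [bp phi_gt0]]]] :
      exists phi phi1 phi2, C2_bump (h0 / 2) ((h0 + H) / 2) phi phi1 phi2 /\
      forall x, h0 / 2 < x < (h0 + H) / 2 -> 0 < phi x.
    by apply: C2_bump_exists; lra.
  have p0 : 0 < h0 / 2 by lra. have qH : (h0 + H) / 2 < H by lra.
  have phih : 0 < phi h0 by apply: phi_gt0; apply/andP; split; lra.
  have := weak _ _ _ _ _ p0 qH bp.
  have [d1 d2 c2 phi0] := bp.
  have phi10 := is_derive_vanish d1 phi0.
  have [dg dgg _] := fp0; have [dk dkk _] := fp1.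
  have -> : \int[mu]_(x in `[0, h0]) (U x * (phi2 x + xi ^+ 2 * phi x)) =
     \int[mu]_(x in `[0, h0]) ((A * (xi^-1 * sin (xi * x))) * (phi2 x + xi ^+ 2 * phi x)).
    by apply: eq_Rintegral_itv => x x01; rewrite UAB// mul0r addr0.
  have dG (x : R) : is_derive x 1 (fun x => A * (xi^-1 * sin (xi * x))) (A * cos (xi * x)).
    by apply: is_derive_funZ; exact: (dg x).1.
  have ddG (x : R) : is_derive x 1 (fun x => A * cos (xi * x))
      (- xi ^+ 2 * (A * (xi^-1 * sin (xi * x)))).
    by apply: (is_derive_eq (is_derive_funZ A (dgg x).1)); ring.
  have dK (x : R) : is_derive x 1 (fun x => E * (eta^-1 * sinh (eta * (H - x))))
      (E * - cosh (eta * (H - x))).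
    by apply: is_derive_funZ; exact: (dk x).1.
  have ddK (x : R) : is_derive x 1 (fun x => E * - cosh (eta * (H - x)))
      (- - eta ^+ 2 * (E * (eta^-1 * sinh (eta * (H - x))))).
    by apply: (is_derive_eq (is_derive_funZ E (dkk x).1)); ring.
  rewrite (@Rintegral_lagrange _ 0 h0 (xi ^+ 2) (fun x => A * (xi^-1 * sin (xi * x)))
     (fun x => A * cos (xi * x)) phi phi1 phi2 (ltW h00) dG ddG d1 d2 c2).
  have -> : \int[mu]_(x in `[h0, H]) (U x * (phi2 x + - eta ^+ 2 * phi x)) =
     \int[mu]_(x in `[h0, H]) ((E * (eta^-1 * sinh (eta * (H - x)))) * (phi2 x + - eta ^+ 2 * phi x)).
    by apply: eq_Rintegral_itv => x x01; rewrite UEF// mul0r addr0.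
  rewrite (@Rintegral_lagrange _ h0 H (- eta ^+ 2) (fun x => E * (eta^-1 * sinh (eta * (H - x))))
     (fun x => E * - cosh (eta * (H - x))) phi phi1 phi2 (ltW hH) dK ddK d1 d2 c2).
  have off0 : ~~ (h0 / 2 <= 0 <= (h0 + H) / 2) by rewrite negb_and -!ltNge p0.
  have offH : ~~ (h0 / 2 <= H <= (h0 + H) / 2) by rewrite negb_and -!ltNge qH orbT.
  rewrite !(phi0 _ off0) !(phi0 _ offH) !(phi10 _ off0) !(phi10 _ offH) -/L.
  have -> : A = C * xi by rewrite /C divfK// gt_eqF.
  have -> : E = E' * eta by rewrite /E' divfK// gt_eqF.
  have -> : C * xi * (xi^-1 * sin (xi * h0)) = C * sin (xi * h0).
    by rewrite mulrA mulfK// gt_eqF.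
  have -> : E' * eta * (eta^-1 * sinh (eta * L)) = C * sin (xi * h0).
    by rewrite eq1 mulrA mulfK// gt_eqF.
  move=> e0; apply: (mulIf (lt0r_neq0 phih)).
  move: e0; rewrite !mulr0; lra.
have C0 : C != 0.
  apply/eqP => C0; move: ux0.
  have s0 : 0 < sinh (eta * L) by apply: sinh_gt0; rewrite mulr_gt0// subr_gt0.
  have E'0 : E' = 0.
    by move/esym/eqP : eq1; rewrite C0 mul0r mulf_eq0 (gt_eqF s0) orbF => /eqP.
  move: x0H; rewrite in_itv/= => /andP[x00 x0H].
  have [xh|hx] := leP x0 h0.
    by rewrite uC ?C0 ?mul0r ?eqxx// (ltW x00).
  by rewrite uE ?E'0 ?mul0r ?eqxx// (ltW hx) ltW.
have s0 : sinh (eta * L) != 0 by rewrite gt_eqF// sinh_gt0// mulr_gt0// subr_gt0.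
split.
  rewrite /dispersion; apply: (mulfI C0).
  rewrite mulrA eq2.
  transitivity (- (eta * cosh (eta * L) * (C * sin (xi * h0)))); last by ring.
  by rewrite eq1; ring.
exists C => //; split => // x xH; rewrite uE//.
rewrite mulrA mulrA eq1; by field.
Qed.

(** * Tensor products in L2 *)

Lemma L2norm_sqr {R : realType} (D : set (R * R)) (v : R * R -> R) :
  L2norm D v ^+ 2 =
  fine (\int[(mu \x mu)%E]_z (((v \_ D) z) ^+ 2)%:E)%E.
Proof.
rewrite /L2norm -powR_mulrn; last by rewrite fine_ge0// Lnorm_ge0.
rewrite -fine_poweR poweR_Lnorm//; congr fine; apply: eq_integral => z _ /=.
by rewrite powR_mulrn// real_normK// num_real.
Qed.

(** Tonelli for the square of the product function. *)
Lemma L2norm_tensor {R : realType} (A B : set R) (F G : R -> R) (v : R * R -> R) :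
  measurable A -> measurable B -> continuous F -> continuous G ->
  mu.-integrable A (EFin \o (fun x => F x ^+ 2)) ->
  mu.-integrable B (EFin \o (fun x => G x ^+ 2)) ->
  (forall x y, A x -> B y -> v (x, y) = F x * G y) ->
  L2norm (A `*` B) v ^+ 2 =
  \int[mu]_(x in A) (F x ^+ 2) * \int[mu]_(y in B) (G y ^+ 2).
Proof.
move=> mA mB cF cG iA iB vE; rewrite L2norm_sqr.
have mF2 : measurable_fun setT (fun x => F x ^+ 2).
  by apply: continuous_measurable_fun; continuity.
have mG2 : measurable_fun setT (fun x => G x ^+ 2).
  by apply: continuous_measurable_fun; continuity.
pose f2 := (fun x => F x ^+ 2) \_ A; pose g2 := (fun x => G x ^+ 2) \_ B.
have mf2 : measurable_fun setT f2.
  apply: (proj1 (measurable_restrictT _ mA)); exact: measurable_funTS.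
have mg2 : measurable_fun setT g2.
  apply: (proj1 (measurable_restrictT _ mB)); exact: measurable_funTS.
have f2_ge0 x : 0 <= f2 x by rewrite /f2 patchE; case: ifP => // _; exact: sqr_ge0.
have g2_ge0 x : 0 <= g2 x by rewrite /g2 patchE; case: ifP => // _; exact: sqr_ge0.
transitivity (fine (\int[(mu \x mu)%E]_z (f2 z.1 * g2 z.2)%:E)%E).
  congr fine; apply: eq_integral => -[x y] _ /=; congr EFin.
  rewrite /f2 /g2 !patchE.
  have -> : ((x, y) \in A `*` B) = (x \in A) && (y \in B).
    by apply/idP/andP => [/set_mem[/mem_set ? /mem_set ?]//|[/set_mem ? /set_mem ?]]; apply/mem_set.
  case: (boolP (x \in A)) => [/set_mem xA|_] /=; last by rewrite mul0r expr0n.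
  case: (boolP (y \in B)) => [/set_mem yB|_] /=; last by rewrite mulr0 expr0n.
  by rewrite vE// exprMn.
rewrite fubini_tonelli1; last 2 first.
- apply/measurable_EFinP/measurable_funM.
    by apply: measurableT_comp => //; exact: measurable_fst.
  by apply: measurableT_comp => //; exact: measurable_snd.
- by move=> z; rewrite lee_fin mulr_ge0.
have IA : (\int[mu]_x (f2 x)%:E = (\int[mu]_(x in A) (F x ^+ 2))%:E)%E.
  rewrite /Rintegral fineK ?integrable_fin_num//.
  by rewrite [RHS]integral_mkcond restrict_EFin.
have IB : (\int[mu]_x (g2 x)%:E = (\int[mu]_(x in B) (G x ^+ 2))%:E)%E.
  rewrite /Rintegral fineK ?integrable_fin_num//.
  by rewrite [RHS]integral_mkcond restrict_EFin.
rewrite /fubini_F /=.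
under eq_integral => x _.
  under eq_integral do rewrite EFinM.
  rewrite ge0_integralZl_EFin//; last 2 first.
  - by move=> y _; rewrite lee_fin.
  - exact/measurable_EFinP.
  rewrite IB.
  over.
rewrite ge0_integralZr//; last 3 first.
- exact/measurable_EFinP.
- by move=> x _; rewrite lee_fin.
- by rewrite lee_fin Rintegral_ge0// => x _; exact: sqr_ge0.
by rewrite IA.
Qed.

(** * Elementary bounds for trigonometric and hyperbolic functions *)

Lemma Rintegral_cst_itv {R : realType} (p q k : R) : p <= q ->
  \int[mu]_(x in `[p, q]) k = k * (q - p).
Proof.
have dk (x : R) : is_derive x 1 (fun x => k * x) (cst k x).
  by apply: (is_derive_eq (is_derive_funZ k (is_derive_id x (1 : R)))); rewrite mulr1.
by move=> pq; rewrite mulrBr -(Rintegral_FTC pq (@cst_continuous _ _ k) dk).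
Qed.

Lemma Rintegral_subset {R : realType} (A B : set R) (f : R -> R) :
  measurable A -> measurable B -> A `<=` B -> (forall x, 0 <= f x) ->
  mu.-integrable B (EFin \o f) ->
  \int[mu]_(x in A) f x <= \int[mu]_(x in B) f x.
Proof.
move=> mA mB AB f0 iB; rewrite /Rintegral fine_le//.
- by apply: integrable_fin_num => //; exact: integrableS iB.
- exact: integrable_fin_num.
- by apply: ge0_subset_integral => //; [exact: measurable_int iB|move=> x _; rewrite lee_fin].
Qed.

Lemma sin_le {R : realType} (x : R) : 0 <= x -> sin x <= x.
Proof.
move=> x0.
have := @Rintegral_FTC _ sin cos 0 x x0 (@continuous_cos R) (@is_derive_sin R).
rewrite sin0 subr0 => <-.
rewrite -[leRHS]subr0 -[leRHS]mul1r -Rintegral_cst_itv//.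
apply: le_Rintegral_itv => [||y _]; [exact: continuous_cos|exact: cst_continuous|].
exact: cos_le1.
Qed.

(** For y < 2 the bound comes from sin y = 2 sin (y/2) cos (y/2) <= y cos (y/2)
    and cos (y/2) <= cos (m/2); for y >= 2 from |sin y| <= 1 <= y/2. *)
Lemma norm_sin_le {R : realType} (m : R) : 0 < m ->
  exists2 theta : R, theta < 1 & forall y, m <= y -> `|sin y| <= theta * y.
Proof.
move=> m0; pose m' := Num.min m 2 / 2.
have m'0 : 0 < m' by rewrite divr_gt0 ?lt_min ?m0 ?ltr0n.
have m'1 : m' <= 1 by rewrite ler_pdivrMr// mul1r ge_min lexx orbT.
have pi2 := @pi_ge2 R.
exists (Num.max (cos m') 2^-1).
  rewrite gt_max; apply/andP; split; last by lra.
  by rewrite -[ltRHS]cos0 ltr_cos// in_itv/=; apply/andP; split; lra.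
move=> y my; have y0 : 0 < y by exact: lt_le_trans my.
have [y2|y2] := leP 2 y.
  rewrite (le_trans (sin_max y))//.
  apply: (@le_trans _ _ (2^-1 * y)); first by lra.
  by rewrite ler_wpM2r ?(ltW y0)// le_max lexx orbT.
have -> : y = (y / 2) *+ 2 by rewrite -mulr_natr divfK.
set z := y / 2.
have z0 : 0 < z by rewrite /z; lra.
have z1 : z < 1 by rewrite /z; lra.
have cz0 : 0 <= cos z by rewrite ltW// cos_gt0_pihalf//; apply/andP; split; lra.
have sz0 : 0 <= sin z by apply: sin_ge0_pi; apply/andP; split; lra.
rewrite sin_mulr2n ger0_norm; last by rewrite mulrn_wge0// mulr_ge0.
rewrite mulrnAr lerMn2r /=.
have mz : m' <= z by rewrite /m' /z ler_pM2r ?invr_gt0// ge_min my.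
apply: (@le_trans _ _ (cos m' * z)); last first.
  by rewrite ler_wpM2r ?(ltW z0)// le_max lexx.
apply: ler_pM => //; last by apply: sin_le; exact: ltW.
move: mz; rewrite le_eqVlt => /predU1P[->//|mz].
by rewrite ltW// ltr_cos// in_itv/=; apply/andP; split; lra.
Qed.

Lemma Rintegral_sin2 {R : realType} (xi p q : R) : p <= q -> xi != 0 ->
  \int[mu]_(x in `[p, q]) (sin (xi * x) ^+ 2) =
  (q - p) / 2 - (sin (xi * q) * cos (xi * q) - sin (xi * p) * cos (xi * p)) / (2 * xi).
Proof.
move=> pq xi0.
pose F x := 2^-1 * x - (2 * xi)^-1 * (sin (xi * x) * cos (xi * x)).
have dF (x : R) : is_derive x 1 F (sin (xi * x) ^+ 2).
  have ds := is_derive_comp_scale (is_derive_sin (xi * x)).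
  have dc := @is_derive_comp_scale _ cos (fun y => - sin y) x xi (is_derive_cos (xi * x)).
  have := is_derive_funD (is_derive_funZ 2^-1 (is_derive_id x (1 : R))) (is_derive_funN (is_derive_funZ (2 * xi)^-1 (is_derive_funM ds dc))).
  move/is_derive_eq; apply.
  transitivity (2^-1 - 2^-1 * (cos (xi * x) ^+ 2 - sin (xi * x) ^+ 2)); first by field.
  by rewrite cos2sin2; field.
have cs : continuous (fun x => sin (xi * x) ^+ 2) by continuity.
by rewrite (Rintegral_FTC pq cs dF) /F; field.
Qed.

(** With y = xi (q - p) the integral is at least (q - p)/2 (1 - |sin y| / y), and
    |sin y| / y stays below some theta < 1 for y >= m (q - p). *)
Lemma Rintegral_sin2_lb {R : realType} (p q m : R) : p < q -> 0 < m ->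
  exists2 d : R, 0 < d & forall xi, m <= xi ->
    d <= \int[mu]_(x in `[p, q]) (sin (xi * x) ^+ 2).
Proof.
move=> pq m0; have qp : 0 < q - p by rewrite subr_gt0.
have [theta theta1 thetaP] := norm_sin_le (mulr_gt0 m0 qp).
exists ((q - p) / 2 * (1 - theta)).
  by rewrite mulr_gt0 ?divr_gt0// subr_gt0.
move=> xi mxi; have xi0 : 0 < xi by exact: lt_le_trans mxi.
rewrite Rintegral_sin2 ?(ltW pq) ?gt_eqF//.
have -> : sin (xi * q) * cos (xi * q) - sin (xi * p) * cos (xi * p) =
    cos (xi * q + xi * p) * sin (xi * (q - p)).
  rewrite mulrBr cosD sinB.
  have e1 := cos2Dsin2 (xi * q); have e2 := cos2Dsin2 (xi * p).
  set sq := sin (xi * q) in e1 *; set sp := sin (xi * p) in e2 *.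
  set cq := cos (xi * q) in e1 *; set cp := cos (xi * p) in e2 *.
  rewrite -[sq * cq]mulr1 -e2 -[sp * cp]mulr1 -e1; ring.
have := thetaP (xi * (q - p)); rewrite ler_wpM2r ?(ltW qp)// => /(_ isT) sy.
have cs : cos (xi * q + xi * p) * sin (xi * (q - p)) <= theta * (xi * (q - p)).
  apply: le_trans sy; rewrite (le_trans (ler_norm _))// normrM.
  by rewrite ler_piMl// cos_max.
set X := cos _ * _ in cs *.
have : X / (2 * xi) <= theta * (xi * (q - p)) / (2 * xi).
  by rewrite ler_pM2r// invr_gt0 mulr_gt0.
have -> : theta * (xi * (q - p)) / (2 * xi) = theta * (q - p) / 2.
  by field; rewrite gt_eqF.
by set Y := X / _; lra.
Qed.

Lemma le_sinh {R : realType} (x y : R) : x <= y -> sinh x <= sinh y.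
Proof.
move=> xy; rewrite /sinh ler_pM2r ?invr_gt0//.
have : expR x <= expR y by rewrite ler_expR.
have : expR (- y) <= expR (- x) by rewrite ler_expR lerN2.
lra.
Qed.

Lemma le_cosh {R : realType} (x y : R) : 0 <= x -> x <= y -> cosh x <= cosh y.
Proof.
move=> x0 xy; rewrite -subr_ge0.
have := Rintegral_FTC xy (@sinh_continuous R) (@is_derive_cosh R) => <-.
apply: Rintegral_ge0 => z; rewrite /= in_itv/= => /andP[xz _].
by apply: sinh_ge0; exact: le_trans xz.
Qed.

Lemma sinh_ge_id {R : realType} (x : R) : 0 <= x -> x <= sinh x.
Proof.
move=> x0; have := Rintegral_FTC x0 (@cosh_continuous R) (@is_derive_sinh R).
rewrite sinh0 subr0 => <-.
rewrite -[leLHS]subr0 -[leLHS]mul1r -Rintegral_cst_itv//.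
apply: le_Rintegral_itv; [exact: cst_continuous|exact: cosh_continuous|].
by move=> y /andP[y0 _]; rewrite -[leLHS]cosh0 le_cosh.
Qed.

Lemma sinh_le_cosh {R : realType} (x : R) : 0 <= x -> sinh x <= x * cosh x.
Proof.
move=> x0; have := Rintegral_FTC x0 (@cosh_continuous R) (@is_derive_sinh R).
rewrite sinh0 subr0 => <-.
have -> : x * cosh x = cosh x * (x - 0) by rewrite subr0 mulrC.
rewrite -Rintegral_cst_itv//.
apply: le_Rintegral_itv; [exact: cosh_continuous|exact: cst_continuous|].
by move=> y /andP[y0 yx]; rewrite le_cosh.
Qed.

(** * The ratio of the two norms *)

(** The vertical part of a guided eigenfunction, normalised by amplitude 1 in the
    lower layer. *)
Definition guided_profile {R : realType} (H h0 xi eta : R) (W : R -> R) : Prop :=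
  [/\ continuous W, forall x, 0 <= x <= h0 -> W x = sin (xi * x) &
      forall x, h0 <= x <= H ->
        W x = sin (xi * h0) / sinh (eta * (H - h0)) * sinh (eta * (H - x))].

Lemma profile_sqr_gt0 {R : realType} (H h0 xi eta : R) (W : R -> R) :
  0 < h0 < H -> 0 < xi -> guided_profile H h0 xi eta W ->
  0 < \int[mu]_(x in `[0, H]) (W x ^+ 2).
Proof.
move=> /andP[h00 hH] xi0 [cW W0 _].
have [d d0 dP] := Rintegral_sin2_lb h00 xi0.
have cW2 : continuous (fun x => W x ^+ 2) by continuity.
rewrite (@Rintegral_itv_split _ 0 h0 H) ?(ltW h00) ?(ltW hH)//.
apply: ltr_pwDl; last by apply: Rintegral_ge0 => x _; exact: sqr_ge0.
apply: (lt_le_trans d0); rewrite (le_trans (dP xi (lexx _)))//.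
rewrite le_eqVlt; apply/orP; left; apply/eqP; apply: eq_Rintegral_itv => x xh.
by rewrite W0.
Qed.

Lemma profile_sqr_le1 {R : realType} (H h0 xi eta : R) (W : R -> R) :
  0 < h0 < H -> 0 < eta -> guided_profile H h0 xi eta W ->
  forall x, 0 <= x <= H -> W x ^+ 2 <= 1.
Proof.
move=> /andP[h00 hH] eta0 [_ W0 W1] x /andP[x0 xH].
have sin2_le1 y : sin y ^+ 2 <= 1 :> R by rewrite sin2cos2 gerBl sqr_ge0.
have [xh|/ltW hx] := leP x h0; first by rewrite W0 ?x0.
rewrite W1 ?hx// mulrAC -mulrA exprMn; apply: mulr_ile1 => //; try exact: sqr_ge0.
have s0 : 0 < sinh (eta * (H - h0)) by rewrite sinh_gt0// mulr_gt0// subr_gt0.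
have t0 : 0 <= sinh (eta * (H - x)).
  by rewrite sinh_ge0// mulr_ge0 ?subr_ge0// ltW.
apply: exprn_ile1; first by rewrite divr_ge0// ltW.
rewrite ler_pdivrMr// mul1r le_sinh//.
by rewrite ler_pM2l// lerD2l lerN2.
Qed.

Lemma profile_sqr_le {R : realType} (H h0 xi eta : R) (W : R -> R) :
  0 < h0 < H -> 0 < eta -> guided_profile H h0 xi eta W ->
  \int[mu]_(x in `[0, H]) (W x ^+ 2) <= H.
Proof.
move=> h0H eta0 gW; have [cW _ _] := gW.
have /andP[h00 hH] := h0H; have H0 : 0 <= H by rewrite ltW// (lt_trans h00).
rewrite -[leRHS]mul1r -[H in leRHS]subr0 -Rintegral_cst_itv//.
apply: le_Rintegral_itv; [by continuity|exact: cst_continuous|].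
exact: profile_sqr_le1 h0H eta0 gW.
Qed.

Lemma Rintegral_sin2_period {R : realType} (k : nat) : (0 < k)%N ->
  \int[mu]_(x in `]0, 1[) (sin (k%:R * pi * x) ^+ 2) = 2^-1 :> R.
Proof.
move=> k0; have kpi : k%:R * pi != 0 :> R.
  by rewrite mulf_neq0 ?pnatr_eq0 -?lt0n// gt_eqF// pi_gt0.
rewrite Rintegral_itv_oocc; last by apply: continuous_integrable_itv; continuity.
rewrite Rintegral_sin2// mulr1 mulr0 sin0.
have -> : sin (k%:R * pi) = 0 :> R.
  elim: {k0 kpi} k => [|k ih]; first by rewrite mul0r sin0.
  by rewrite -natr1 mulrDl mul1r sinDpi ih oppr0.
by rewrite !mul0r subrr mul0r !subr0 mul1r.
Qed.

(** The constants alpha and C of the eigenfunction cancel, and the horizontal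
    factor has squared norm 1/2 on (0, 1): this is the factor 2. *)
Lemma ratio_eq {R : realType} (H h0 c1 : R) (omega1 : set R) (a b alpha : R)
    k lambda (u : R -> R) (xi eta : R) :
  0 < h0 < H -> measurable omega1 -> omega1 `<=` `]0, 1[%classic ->
  0 <= a < b -> b <= H -> alpha != 0 -> (0 < k)%N ->
  mode H h0 c1 k lambda u -> 0 < xi -> 0 < eta ->
  lambda - k%:R ^+ 2 * pi ^+ 2 = xi ^+ 2 ->
  lambda / c1 - k%:R ^+ 2 * pi ^+ 2 = - eta ^+ 2 ->
  dispersion H h0 xi eta /\
  exists2 W : R -> R, guided_profile H h0 xi eta W &
    L2norm (omega1 `*` `]a, b[%classic) (eigenfunction alpha k u) ^+ 2 /
      L2norm (strip 0 H) (eigenfunction alpha k u) ^+ 2 =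
    2 * \int[mu]_(x in omega1) (sin (k%:R * pi * x) ^+ 2) *
    (\int[mu]_(x in `[a, b]) (W x ^+ 2) / \int[mu]_(x in `[0, H]) (W x ^+ 2)).
Proof.
move=> h0H mo o01 /andP[a0 ab] bH alpha0 k0 um xi0 eta0 q0E q1E.
have [disp [C C0 [uC1 uC2]]] := mode_profile h0H um xi0 eta0 q0E q1E.
split=> //.
have [cu _ _ _ _] := um.
have /andP[h00 hH] := h0H; have H0 : 0 < H := lt_trans h00 hH.
have [U cU UE] := extend_continuous (ltW H0) cu.
have gW : guided_profile H h0 xi eta (fun x => C^-1 * U x).
  split; first by continuity.
  - move=> x /andP[x0 xh].
    by rewrite UE ?x0 ?(le_trans xh) ?(ltW hH)// uC1 ?x0// mulKf.
  - move=> x /andP[hx xH].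
    by rewrite UE ?xH ?(le_trans (ltW h00))// uC2 ?hx// mulKf.
exists (fun x => C^-1 * U x) => //.
set W := fun x => C^-1 * U x in gW *.
have D0 := profile_sqr_gt0 h0H xi0 gW.
have [cW _ _] := gW.
pose F x := alpha * Num.sqrt 2 * sin (k%:R * pi * x).
have cF : continuous F by rewrite /F; continuity.
have UW x : U x = C * W x by rewrite /W mulVKf.
have tensor (A : set R) (p q : R) : measurable A -> A `<=` `]0, 1[%classic -> 0 <= p -> p <= q -> q <= H ->
    L2norm (A `*` `]p, q[%classic) (eigenfunction alpha k u) ^+ 2 =
    (2 * alpha ^+ 2 * C ^+ 2) *
    (\int[mu]_(x in A) (sin (k%:R * pi * x) ^+ 2) * \int[mu]_(x in `[p, q]) (W x ^+ 2)).
  move=> mA A01 p0 pq qH.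
  have iA (f : R -> R) : continuous f -> mu.-integrable A (EFin \o f).
    move=> cf; have := continuous_integrable_itv 0 1 cf; apply: integrableS => //.
    by apply: subset_trans A01 _; exact: subset_itv_oo_cc.
  have iB (f : R -> R) : continuous f -> mu.-integrable `]p, q[ (EFin \o f).
    move=> cf; have := continuous_integrable_itv p q cf; apply: integrableS => //.
    exact: subset_itv_oo_cc.
  rewrite (@L2norm_tensor _ A _ F U)//.
  - rewrite Rintegral_itv_oocc; last by apply: continuous_integrable_itv; continuity.
    have -> : \int[mu]_(x in A) (F x ^+ 2) =
        \int[mu]_(x in A) ((2 * alpha ^+ 2) * (sin (k%:R * pi * x) ^+ 2)).
      by apply: eq_Rintegral => x _; rewrite /F !exprMn sqr_sqrtr//; ring.
    rewrite RintegralZl//; last by apply: iA; continuity.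
    have -> : \int[mu]_(x in `[p, q]) (U x ^+ 2) =
        \int[mu]_(x in `[p, q]) (C ^+ 2 * (W x ^+ 2)).
      by apply: eq_Rintegral => x _; rewrite UW exprMn.
    by rewrite Rintegral_itvZ; [ring|continuity].
  - by apply: iA; continuity.
  - by apply: iB; continuity.
  - move=> x y _; rewrite /= in_itv/= => /andP[py yq].
    rewrite /eigenfunction/= UE//.
    by rewrite (le_trans p0 (ltW py)) (le_trans (ltW yq) qH).
rewrite /strip !tensor ?(ltW ab) ?(ltW H0)//.
rewrite Rintegral_sin2_period//.
by field; rewrite gt_eqF// C0 alpha0.
Qed.

(** * Bounds from below by the dispersion relation *)

(** For xi h0 <= 1 < pi/2 the left side of the dispersion relation would be
    nonnegative and the right side negative. *)
Lemma dispersion_phase {R : realType} (H h0 xi eta : R) :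
  0 < h0 < H -> 0 < xi -> 0 < eta -> dispersion H h0 xi eta -> 1 < xi * h0.
Proof.
move=> /andP[h00 hH] xi0 eta0 disp; rewrite ltNge; apply/negP => x1.
have pi2 := @pihalf_ge1 R; have x0 : 0 < xi * h0 by rewrite mulr_gt0.
have s0 : 0 < sin (xi * h0) by apply: sin_gt0_pi; apply/andP; split; lra.
have k0 : 0 <= cos (xi * h0) by apply: cos_ge0_pihalf; apply/andP; split; lra.
have sh0 : 0 < sinh (eta * (H - h0)) by rewrite sinh_gt0// mulr_gt0// subr_gt0.
have ch0 := cosh_gt0 (eta * (H - h0)).
have : 0 <= xi * cos (xi * h0) * sinh (eta * (H - h0)).
  by rewrite mulr_ge0 ?(ltW sh0)// mulr_ge0// ltW.
by rewrite disp oppr_ge0 leNgt mulr_gt0 // mulr_gt0.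
Qed.

(** Squaring the dispersion relation and inserting cos^2 = 1 - sin^2,
    sinh (eta L) >= eta L and xi h0 > 1, with L = H - h0, bounds sin^2 (xi h0)
    from below as long as eta stays bounded. *)
Lemma dispersion_sin_lb {R : realType} (H h0 xi eta M : R) :
  0 < h0 < H -> 0 < xi -> 0 < eta -> eta <= M -> dispersion H h0 xi eta ->
  (H - h0) ^+ 2 <=
    sin (xi * h0) ^+ 2 * (cosh (M * (H - h0)) ^+ 2 * h0 ^+ 2 + (H - h0) ^+ 2).
Proof.
move=> h0H xi0 eta0 etaM disp; have xh := dispersion_phase h0H xi0 eta0 disp.
have /andP[h00 hH] := h0H.
set L := H - h0 in disp *; have L0 : 0 < L by rewrite subr_gt0.
have sh : eta * L <= sinh (eta * L) by rewrite sinh_ge_id// mulr_ge0// ltW.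
have ch : cosh (eta * L) <= cosh (M * L).
  by rewrite le_cosh ?ler_pM2r// mulr_ge0// ltW.
have ch0 := cosh_gt0 (eta * L).
have sq : (xi * sinh (eta * L)) ^+ 2 * (1 - sin (xi * h0) ^+ 2) =
          (eta * cosh (eta * L)) ^+ 2 * sin (xi * h0) ^+ 2.
  rewrite -cos2sin2 -!exprMn -[RHS]sqrrN -disp; congr (_ ^+ 2); ring.
set S := sin (xi * h0) ^+ 2 in sq *.
have S1 : 0 <= 1 - S by rewrite /S -cos2sin2 sqr_ge0.
have S0 : 0 <= S by rewrite /S sqr_ge0.
have e1 : (eta * L) ^+ 2 <= (xi * h0 * sinh (eta * L)) ^+ 2.
  have v0 : 0 <= eta * L by rewrite mulr_ge0// ltW.
  have t0 : 0 <= sinh (eta * L) by exact: sinh_ge0.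
  have u0 : 0 <= xi * h0 * sinh (eta * L) by rewrite mulr_ge0// ltW// mulr_gt0.
  rewrite ler_pXn2r ?nnegrE//.
  by apply: (le_trans sh); rewrite ler_peMl// ltW.
have e2 : cosh (eta * L) ^+ 2 <= cosh (M * L) ^+ 2.
  by rewrite ler_pXn2r// nnegrE ltW// cosh_gt0.
have key : eta ^+ 2 * ((1 - S) * L ^+ 2) <= eta ^+ 2 * (S * (cosh (M * L) ^+ 2 * h0 ^+ 2)).
  apply: (@le_trans _ _ ((xi * h0 * sinh (eta * L)) ^+ 2 * (1 - S))).
    by rewrite mulrCA mulrC -exprMn ler_wpM2r.
  have -> : (xi * h0 * sinh (eta * L)) ^+ 2 * (1 - S) =
      h0 ^+ 2 * ((xi * sinh (eta * L)) ^+ 2 * (1 - S)) by ring.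
  rewrite sq.
  have -> : h0 ^+ 2 * ((eta * cosh (eta * L)) ^+ 2 * S) =
      eta ^+ 2 * (S * (cosh (eta * L) ^+ 2 * h0 ^+ 2)) by ring.
  rewrite ler_wpM2l ?sqr_ge0// ler_wpM2l// ler_wpM2r ?sqr_ge0//.
move: key; rewrite ler_pM2l ?exprn_gt0// mulrBl mul1r lerBlDr -mulrDr.
by [].
Qed.

(** On the lower half [a, m] of the slab, W / sin (xi h0) is at least
    (H - m) / (L cosh (M L)), since eta t <= sinh (eta t) <= eta t cosh (eta t).
    The half slab keeps H - x away from 0 even when b = H. *)
Lemma upper_layer_lb {R : realType} (H h0 a b M : R) :
  0 < h0 < H -> h0 <= a -> a < b -> b <= H ->
  exists2 d : R, 0 < d & forall xi eta W, 0 < xi -> 0 < eta -> eta <= M ->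
    dispersion H h0 xi eta -> guided_profile H h0 xi eta W ->
    d <= \int[mu]_(x in `[a, b]) (W x ^+ 2).
Proof.
move=> h0H ha ab bH; have /andP[h00 hH] := h0H.
pose L := H - h0; have L0 : 0 < L by rewrite subr_gt0.
pose K := cosh (M * L); have K0 : 0 < K := cosh_gt0 _.
pose m := (a + b) / 2; have am : a < m by rewrite /m; lra.
have mb : m < b by rewrite /m; lra.
have den0 : 0 < K ^+ 2 * h0 ^+ 2 + L ^+ 2.
  by rewrite addr_gt0 ?exprn_gt0 // mulr_gt0 ?exprn_gt0.
pose e := L ^+ 2 / (K ^+ 2 * h0 ^+ 2 + L ^+ 2) * ((H - m) / (L * K)) ^+ 2.
have Hm : 0 < H - m by rewrite subr_gt0; lra.
have e0 : 0 < e.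
  have LK0 : 0 < L * K by rewrite mulr_gt0.
  apply: mulr_gt0; first by rewrite divr_gt0 // exprn_gt0.
  by rewrite exprn_gt0 // divr_gt0.
exists (e * (m - a)); first by rewrite mulr_gt0// subr_gt0.
move=> xi eta W xi0 eta0 etaM disp [cW _ W1].
have cW2 : continuous (fun x => W x ^+ 2) by continuity.
rewrite (@Rintegral_itv_split _ a m b) ?(ltW am) ?(ltW mb)//.
apply: ler_wpDr; first by apply: Rintegral_ge0 => x _; exact: sqr_ge0.
rewrite -Rintegral_cst_itv ?(ltW am)//.
apply: le_Rintegral_itv => //; first exact: cst_continuous.
move=> x /andP[ax xm].
rewrite W1; last by rewrite (le_trans ha ax)/=; lra.
rewrite mulrAC -mulrA exprMn -/L /e.
have s0 : 0 < sinh (eta * L) by rewrite sinh_gt0// mulr_gt0.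
apply: ler_pM.
- by rewrite divr_ge0 ?sqr_ge0// ltW.
- exact: sqr_ge0.
- by rewrite ler_pdivrMr//; exact: dispersion_sin_lb h0H xi0 eta0 etaM disp.
have Hx : 0 <= H - x by lra.
have LK0 : 0 < L * K by rewrite mulr_gt0.
have q0 : 0 <= (H - m) / (L * K) by rewrite divr_ge0// ltW.
have r0 : 0 <= sinh (eta * (H - x)) / sinh (eta * L).
  by rewrite divr_ge0 ?(ltW s0)//; apply: sinh_ge0; rewrite mulr_ge0// ltW.
have L0' : 0 <= eta * L by rewrite mulr_ge0// ltW.
rewrite ler_pXn2r ?nnegrE// ler_pdivlMr// mulrAC ler_pdivrMr//.
apply: (@le_trans _ _ ((H - m) * (eta * L * K))).
  rewrite ler_pM2l//; apply: (le_trans (sinh_le_cosh L0')).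
  by rewrite ler_pM2l ?mulr_gt0//; apply: le_cosh => //; rewrite ler_pM2r.
have -> : (H - m) * (eta * L * K) = (eta * (H - m)) * (L * K) by ring.
rewrite ler_pM2r//.
apply: (@le_trans _ _ (eta * (H - x))); first by rewrite ler_pM2l//; lra.
by apply: sinh_ge_id; rewrite mulr_ge0// ltW.
Qed.

Lemma lower_layer_lb {R : realType} (H h0 a b : R) :
  0 < h0 < H -> 0 <= a -> a < b -> b <= h0 ->
  exists2 d : R, 0 < d & forall xi eta W, 0 < xi -> 0 < eta ->
    dispersion H h0 xi eta -> guided_profile H h0 xi eta W ->
    d <= \int[mu]_(x in `[a, b]) (W x ^+ 2).
Proof.
move=> h0H a0 ab bh; have /andP[h00 hH] := h0H.
have [|d d0 dP] := @Rintegral_sin2_lb _ a b h0^-1 ab; first by rewrite invr_gt0.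
exists d => // xi eta W xi0 eta0 disp [_ W0 _].
have -> : \int[mu]_(x in `[a, b]) (W x ^+ 2) = \int[mu]_(x in `[a, b]) (sin (xi * x) ^+ 2).
  apply: eq_Rintegral_itv => x /andP[ax xb].
  by rewrite W0// (le_trans a0 ax) (le_trans xb bh).
apply: dP; rewrite -div1r ler_pdivrMr// ltW//.
exact: dispersion_phase h0H xi0 eta0 disp.
Qed.

Lemma open_itv_sub {R : realType} (A : set R) : open A -> A !=set0 ->
  exists p q : R, p < q /\ `[p, q]%classic `<=` A.
Proof.
move=> oA [x Ax]; have [e /= e0 eA] := (@nbhs_ballP _ _ x A).1 (oA x Ax).
exists (x - e / 2), (x + e / 2); split; first by lra.
move=> y /=; rewrite in_itv/= => /andP[y1 y2]; apply: eA.
by rewrite /ball/= ltr_norml; apply/andP; split; lra.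
Qed.

Lemma cross_section_lb {R : realType} (omega1 : set R) :
  open omega1 -> omega1 !=set0 -> omega1 `<=` `]0, 1[%classic ->
  exists2 d : R, 0 < d & forall k, (0 < k)%N ->
    d <= \int[mu]_(x in omega1) (sin (k%:R * pi * x) ^+ 2).
Proof.
move=> oo o0 o01; have [p [q [pq pqo]]] := open_itv_sub oo o0.
have [d d0 dP] := Rintegral_sin2_lb pq (@pi_gt0 R).
exists d => // k k0; apply: (le_trans (dP (k%:R * pi) _)).
  by rewrite ler_peMl ?pi_ge0// ler1n.
have cs : continuous (fun x : R => sin (k%:R * pi * x) ^+ 2) by continuity.
apply: Rintegral_subset => //.
- exact: open_measurable.
- by move=> x; exact: sqr_ge0.
- have := continuous_integrable_itv 0 1 cs; apply: integrableS => //.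
    exact: open_measurable.
  by apply: subset_trans o01 _; exact: subset_itv_oo_cc.
Qed.

Lemma inf_range_gt0 {R : realType} (f : nat -> R) (d : R) :
  0 < d -> (forall n, d <= f n) -> 0 < inf (range f).
Proof.
move=> d0 df; apply: (lt_le_trans d0); apply: lb_le_inf.
  by exists (f 0%N), 0%N.
by move=> _ [n _ <-].
Qed.

(** * Riemann-Lebesgue on the unit interval *)

(** Bessel's inequality for the indicator of A in the orthogonal system
    cos (2 (n+1) pi x) of L2(0, 1): the cosine coefficients of A are square
    summable, hence tend to 0.  It is obtained from the positivity of the
    integral over A of (1 - S_N)^2, with S_N a partial Fourier sum. *)
Section bessel.
Context {R : realType} (A : set R).
Hypothesis mA : measurable A.
Hypothesis A01 : A `<=` `]0, 1[%classic.

Let e (n : nat) (x : R) : R := cos (2 * (n.+1%:R * pi) * x).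
Let c (n : nat) : R := \int[mu]_(x in A) e n x.

Let partial_sum := fix S (N : nat) (x : R) : R :=
  if N is N'.+1 then S N' x + (2 * c N') * e N' x else 0.

Let ce n : continuous (e n). Proof. by rewrite /e; continuity. Qed.

Let cS N : continuous (partial_sum N).
Proof.
elim: N => [|N ih] /=; first exact: cst_continuous.
by have h := @ce N; continuity.
Qed.

Let iA (f : R -> R) : continuous f -> mu.-integrable A (EFin \o f).
Proof.
move=> cf; have := continuous_integrable_itv 0 1 cf; apply: integrableS => //.
by apply: subset_trans A01 _; exact: subset_itv_oo_cc.
Qed.

Let sin_period (n : nat) : sin (n%:R * pi) = 0 :> R.
Proof.
elim: n => [|n ih]; first by rewrite mul0r sin0.
by rewrite -natr1 mulrDl mul1r sinDpi ih oppr0.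
Qed.

Let int_cos (r : R) : r != 0 -> sin r = 0 -> \int[mu]_(x in `[0, 1]) cos (r * x) = 0.
Proof.
move=> r0 sr0.
have dF (x : R) : is_derive x 1 (fun x => r^-1 * sin (r * x)) (cos (r * x)).
  apply: (is_derive_eq (is_derive_funZ r^-1 (is_derive_comp_scale (is_derive_sin (r * x))))).
  by rewrite mulKf.
have cc : continuous (fun x => cos (r * x)) by continuity.
by rewrite (Rintegral_FTC (@ler01 R) cc dF) mulr1 mulr0 sr0 sin0 subrr.
Qed.

Let sin2n (n : nat) : sin (2 * (n.+1%:R * pi)) = 0 :> R.
Proof. by rewrite mulrA -natrM sin_period. Qed.

Let prodE m n x : e m x * e n x =
  2^-1 * cos ((2 * (m.+1%:R * pi) - 2 * (n.+1%:R * pi)) * x) +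
  2^-1 * cos ((2 * (m.+1%:R * pi) + 2 * (n.+1%:R * pi)) * x).
Proof.
rewrite /e; set r := 2 * _; set s := 2 * _.
rewrite (_ : (r - s) * x = r * x - s * x); last by ring.
rewrite (_ : (r + s) * x = r * x + s * x); last by ring.
by rewrite cosB cosD; field.
Qed.

Let sum_neq0 m n : 2 * (m.+1%:R * pi) + 2 * (n.+1%:R * pi) != 0 :> R.
Proof. by rewrite gt_eqF// addr_gt0// !mulr_gt0// pi_gt0. Qed.

Let e_orth m n : m != n -> \int[mu]_(x in `[0, 1]) (e m x * e n x) = 0.
Proof.
move=> mn; under [LHS]eq_Rintegral do rewrite prodE.
rewrite Rintegral_itvD; [|by continuity|by continuity].
rewrite Rintegral_itvZ; last by continuity. rewrite Rintegral_itvZ; last by continuity.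
rewrite !int_cos ?mulr0 ?addr0//.
- by rewrite sinD !sin2n mul0r mulr0 addr0.
- rewrite -mulrBr -mulrBl; apply: mulf_neq0 => //; apply: mulf_neq0.
    by rewrite subr_eq0 eqr_nat eqSS.
  by rewrite gt_eqF// pi_gt0.
- by rewrite sinB !sin2n mul0r mulr0 subr0.
Qed.

Let e_norm n : \int[mu]_(x in `[0, 1]) (e n x * e n x) = 2^-1.
Proof.
under [LHS]eq_Rintegral do rewrite prodE subrr mul0r cos0 mulr1.
rewrite Rintegral_itvD; [|exact: cst_continuous|by continuity].
rewrite Rintegral_itvZ; last by continuity.
rewrite Rintegral_cst_itv// int_cos//; first by rewrite mulr0 addr0 subr0 mulr1.
by rewrite sinD !sin2n mul0r mulr0 addr0.
Qed.

Let S_orth N n : (N <= n)%N -> \int[mu]_(x in `[0, 1]) (partial_sum N x * e n x) = 0.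
Proof.
have h := @ce n.
elim: N => [|N ih] Nn /=.
  under eq_Rintegral do rewrite mul0r.
  by rewrite Rintegral_cst_itv// mul0r.
have hN := @ce N; have hS := @cS N.
under eq_Rintegral do rewrite mulrDl -mulrA.
rewrite Rintegral_itvD; [|by continuity|by continuity].
rewrite ih ?(ltnW Nn)// Rintegral_itvZ; last by continuity.
by rewrite e_orth ?mulr0 ?addr0// ltn_eqF.
Qed.

Let Q := series (fun n => 2 * c n ^+ 2).

Let S_norm N : \int[mu]_(x in `[0, 1]) (partial_sum N x ^+ 2) = Q N.
Proof.
elim: N => [|N ih] /=.
  rewrite /Q seriesEnat/= big_geq//.
  under eq_Rintegral do rewrite expr0n.
  by rewrite Rintegral_cst_itv// mul0r.
have hN := @ce N; have hS := @cS N.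
transitivity (\int[mu]_(x in `[0, 1]) (partial_sum N x ^+ 2 +
   ((4 * c N) * (partial_sum N x * e N x) + (4 * c N ^+ 2) * (e N x * e N x)))).
  by apply: eq_Rintegral => x _; ring.
rewrite Rintegral_itvD; [|by continuity|by continuity]. rewrite Rintegral_itvD; [|by continuity|by continuity].
rewrite Rintegral_itvZ; last by continuity. rewrite Rintegral_itvZ; last by continuity.
rewrite ih S_orth// e_norm mulr0 add0r /Q [RHS]seriesSr; congr (_ + _).
by field.
Qed.

Let S_A N : \int[mu]_(x in A) partial_sum N x = Q N.
Proof.
elim: N => [|N ih] /=.
  by rewrite /Q seriesEnat/= big_geq// Rintegral_cst// mul0r.
have hN := @ce N; have hS := @cS N.
rewrite RintegralD//; [|exact: iA|by apply: iA; continuity].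
rewrite ih RintegralZl//; last exact: iA.
rewrite /Q [RHS]seriesSr; congr (_ + _).
by rewrite -/(c N) -mulrA.
Qed.

Let bessel N : Q N <= 1.
Proof.
have hS := @cS N.
have : 0 <= \int[mu]_(x in A) ((1 - partial_sum N x) ^+ 2).
  by apply: Rintegral_ge0 => x _; exact: sqr_ge0.
have -> : \int[mu]_(x in A) ((1 - partial_sum N x) ^+ 2) =
    \int[mu]_(x in A) 1 + (\int[mu]_(x in A) (partial_sum N x ^+ 2) - 2 * Q N).
  rewrite -S_A -RintegralZl//; last exact: iA.
  rewrite -RintegralB//; [|by apply: iA; continuity|by apply: iA; continuity].
  rewrite -RintegralD//; [|by apply: iA; exact: cst_continuous|by apply: iA; continuity].
  by apply: eq_Rintegral => x _; ring.
have h1 : \int[mu]_(x in A) (partial_sum N x ^+ 2) <= Q N.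
  rewrite -S_norm; apply: Rintegral_subset => //.
  - by apply: subset_trans A01 _; exact: subset_itv_oo_cc.
  - by move=> x; exact: sqr_ge0.
  - by apply: continuous_integrable_itv; continuity.
have h2 : \int[mu]_(x in A) (1 : R) <= 1.
  have -> : \int[mu]_(x in A) (1 : R) <= 1 =
      (\int[mu]_(x in A) (1 : R) <= \int[mu]_(x in `[0, 1]) (1 : R)).
    by rewrite [in RHS]Rintegral_cst_itv// subr0 mulr1.
  apply: Rintegral_subset => //.
  - by apply: subset_trans A01 _; exact: subset_itv_oo_cc.
  - by apply: continuous_integrable_itv; exact: cst_continuous.
move: h1 h2; set i1 := \int[mu]_(x in A) 1; set i2 := Rintegral _ _ _.
set q := Q N; lra.
Qed.

Lemma cos_coefficient_cvg0 :
  \int[mu]_(x in A) cos (2 * (n.+1%:R * pi) * x) @[n --> \oo] --> (0 : R).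
Proof.
have cvQ : cvgn Q.
  apply: nondecreasing_is_cvgn.
    apply/nondecreasing_seqP => n; rewrite /Q [leRHS]seriesSr lerDl.
    by rewrite mulr_ge0// sqr_ge0.
  by exists 1 => _ [n _ <-]; exact: bessel.
have c2 : 2 * c n ^+ 2 @[n --> \oo] --> (0 : R) by exact: cvg_series_cvg_0 cvQ.
apply/cvgrPdist_le => eps eps0.
have e20 : 0 < 2 * eps ^+ 2 by rewrite mulr_gt0// exprn_gt0.
have ev : \forall n \near \oo, `|0 - 2 * c n ^+ 2| <= 2 * eps ^+ 2.
  exact: (cvgr_dist_le _ _ c2).
near=> n.
have : `|0 - 2 * c n ^+ 2| <= 2 * eps ^+ 2 by near: n; exact: ev.
rewrite !sub0r !normrN -/(c n) normrM normrX ger0_norm// ler_pM2l//.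
by rewrite ler_pXn2r// nnegrE ltW.
Unshelve. all: by end_near. Qed.

End bessel.

(** * Exponential limits in the upper layer *)

Section sequence_limits.
Context {R : realType}.
Implicit Types (u v : nat -> R) (a b : R).

Lemma seq_cvg_cst a : a @[_ --> \oo] --> a. Proof. exact: cvg_cst. Qed.

Lemma seq_cvgD u v a b : u n @[n --> \oo] --> a -> v n @[n --> \oo] --> b ->
  u n + v n @[n --> \oo] --> a + b.
Proof. by move=> ua vb; exact: cvgD. Qed.

Lemma seq_cvgB u v a b : u n @[n --> \oo] --> a -> v n @[n --> \oo] --> b ->
  u n - v n @[n --> \oo] --> a - b.
Proof. by move=> ua vb; exact: cvgB. Qed.

Lemma seq_cvgM u v a b : u n @[n --> \oo] --> a -> v n @[n --> \oo] --> b ->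
  u n * v n @[n --> \oo] --> a * b.
Proof. by move=> ua vb; exact: cvgM. Qed.

Lemma seq_cvgV u a : a != 0 -> u n @[n --> \oo] --> a ->
  (u n)^-1 @[n --> \oo] --> a^-1.
Proof. by move=> a0 ua; exact: cvgV. Qed.

End sequence_limits.

Section exponential_limits.
Context {R : realType} (X : nat -> R).
Hypothesis X0 : forall n, 0 < X n.
Hypothesis Xy : X n @[n --> \oo] --> +oo.

Lemma inv_seq_cvg0 : (X n)^-1 @[n --> \oo] --> (0 : R).
Proof. by apply/(@gtr0_cvgV0 R nat \oo _ X) => //; apply: nearW. Qed.

Lemma scaled_inv_seq_cvg0 (k : R) : k * (X n)^-1 @[n --> \oo] --> (0 : R).
Proof. by rewrite -[X in _ --> X](mulr0 k); apply: cvgM; [exact: cvg_cst|exact: inv_seq_cvg0]. Qed.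

Lemma expN_cvg0 (r : R) : 0 < r -> expR (- (r * X n)) @[n --> \oo] --> (0 : R).
Proof.
move=> r0; apply: (@squeeze_cvgr _ _ _ _ (cst 0) (fun n => r^-1 * (X n)^-1)).
- apply: nearW => n; rewrite expR_ge0/= expRN -invfM.
  have rX : 0 < r * X n by rewrite mulr_gt0.
  rewrite [leRHS]/GRing.inv lef_pV2 ?posrE ?expR_gt0//.
  by apply: le_trans (expR_ge1Dx _); rewrite lerDr.
- exact: cvg_cst.
- exact: scaled_inv_seq_cvg0.
Qed.

(** The quadratic term of the exponential series gives
    x exp (- r x) <= 2 / (r^2 x). *)
Lemma mulexpN_cvg0 (r : R) : 0 < r -> X n * expR (- (r * X n)) @[n --> \oo] --> (0 : R).
Proof.
move=> r0; apply: (@squeeze_cvgr _ _ _ _ (cst 0) (fun n => (2 / r ^+ 2) * (X n)^-1)).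
- apply: nearW => n; have Xn := X0 n.
  have rX : 0 < r * X n by rewrite mulr_gt0.
  rewrite mulr_ge0 ?expR_ge0 ?(ltW Xn)//= expRN ler_pdivrMr ?expR_gt0//.
  have := expR_ge1Dxn 1 (ltW rX); rewrite (_ : 2`! = 2%N)// => h.
  have e : (r * X n) ^+ 2 / 2 <= expR (r * X n) by apply: le_trans h; rewrite lerDr.
  apply: (@le_trans _ _ (2 / r ^+ 2 * (X n)^-1 * ((r * X n) ^+ 2 / 2))).
    rewrite le_eqVlt; apply/orP; left; apply/eqP; field.
    by rewrite !gt_eqF.
  by rewrite ler_wpM2l// mulr_ge0 ?invr_ge0 ?(ltW Xn)// divr_ge0// sqr_ge0.
- exact: cvg_cst.
- exact: scaled_inv_seq_cvg0.
Qed.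

End exponential_limits.

Lemma Rintegral_sinh2 {R : realType} (H eta a b : R) : a <= b -> eta != 0 ->
  \int[mu]_(x in `[a, b]) (sinh (eta * (H - x)) ^+ 2) =
  (sinh (eta * (H - a)) * cosh (eta * (H - a)) -
   sinh (eta * (H - b)) * cosh (eta * (H - b))) / (2 * eta) - (b - a) / 2.
Proof.
move=> ab eta0.
have dl (x : R) : is_derive x 1 (fun y => eta * (H - y)) (- eta).
  have := is_derive_funZ eta (is_derive_funD (is_derive_cst H x (1 : R)) (is_derive_funN (is_derive_id x (1 : R)))).
  by rewrite add0r mulrN1.
have ds (x : R) : is_derive x 1 (fun y => sinh (eta * (H - y))) (cosh (eta * (H - x)) * - eta).
  exact: (@is_derive_fun_comp _ sinh (fun y => eta * (H - y)) _ _ _ (is_derive_sinh _) (dl x)).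
have dc (x : R) : is_derive x 1 (fun y => cosh (eta * (H - y))) (sinh (eta * (H - x)) * - eta).
  exact: (@is_derive_fun_comp _ cosh (fun y => eta * (H - y)) _ _ _ (is_derive_cosh _) (dl x)).
pose F x := - (2 * eta)^-1 * (sinh (eta * (H - x)) * cosh (eta * (H - x))) + - (2^-1 * x).
have dF (x : R) : is_derive x 1 F (sinh (eta * (H - x)) ^+ 2).
  have := is_derive_funD (is_derive_funZ (- (2 * eta)^-1) (is_derive_funM (ds x) (dc x))) (is_derive_funN (is_derive_funZ 2^-1 (is_derive_id x (1 : R)))).
  move/is_derive_eq; apply.
  transitivity (2^-1 * (cosh (eta * (H - x)) ^+ 2 + sinh (eta * (H - x)) ^+ 2) - 2^-1).
    by field.
  have e : cosh (eta * (H - x)) ^+ 2 = 1 + sinh (eta * (H - x)) ^+ 2.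
    by rewrite -(cosh2_sinh2 (eta * (H - x))) subrK.
  by rewrite e; field.
have cs : continuous (fun x => sinh (eta * (H - x)) ^+ 2).
  by apply: continuous_funX; exact: is_derive_continuous ds.
by rewrite (Rintegral_FTC ab cs dF) /F; field.
Qed.

(** What remains of the integral of the squared profile over [a, b] after its
    leading exponential is taken out; it tends to 1 with eta. *)
Definition layer_factor {R : realType} (H h0 a b eta : R) : R :=
  (1 - expR (- (4 * (H - a) * eta)) - expR (- (2 * (b - a) * eta)) +
     expR (- (2 * (H - a + (H - b)) * eta))
     - 4 * (b - a) * (eta * expR (- (2 * (H - a) * eta)))) /
    (1 - expR (- (2 * (H - h0) * eta))) ^+ 2.

Lemma layer_integral_exp {R : realType} (H h0 a b eta : R) :
  h0 < H -> a <= b -> 0 < eta ->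
  \int[mu]_(x in `[a, b]) ((sinh (eta * (H - x)) / sinh (eta * (H - h0))) ^+ 2) =
  expR (- (2 * (a - h0) * eta)) / (2 * eta) * layer_factor H h0 a b eta.
Proof.
move=> hH ab eta0.
have s0 : 0 < sinh (eta * (H - h0)) by rewrite sinh_gt0// mulr_gt0// subr_gt0.
transitivity ((sinh (eta * (H - h0)))^-2 *
    \int[mu]_(x in `[a, b]) (sinh (eta * (H - x)) ^+ 2)).
  rewrite -Rintegral_itvZ; last first.
    apply: continuous_funX; apply: (@continuous_fun_comp _ _ (fun x => eta * (H - x)) sinh).
      exact: sinh_continuous.
    by continuity.
  by apply: eq_Rintegral_itv => x _; rewrite exprMn exprVn mulrC.
rewrite Rintegral_sinh2 ?gt_eqF// /layer_factor.
set p := expR (eta * (H - a)); set q := expR (eta * (H - b)); set l := expR (eta * (H - h0)).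
have p0 : 0 < p := expR_gt0 _. have q0 : 0 < q := expR_gt0 _. have l0 : 0 < l := expR_gt0 _.
have l1 : 1 < l by rewrite /l -expR0 ltr_expR mulr_gt0// subr_gt0.
have -> : expR (- (2 * (a - h0) * eta)) = (p / l) ^+ 2.
  by rewrite /p /l -expRN -expRD -expRM_natl; congr expR; ring.
have -> : expR (- (4 * (H - a) * eta)) = p ^- 4.
  by rewrite /p -exprVn -expRN -expRM_natl; congr expR; ring.
have -> : expR (- (2 * (b - a) * eta)) = (q / p) ^+ 2.
  by rewrite /p /q -expRN -expRD -expRM_natl; congr expR; ring.
have -> : expR (- (2 * (H - a + (H - b)) * eta)) = (p * q) ^- 2.
  by rewrite /p /q -exprVn -expRD -expRN -expRM_natl; congr expR; ring.
have -> : expR (- (2 * (H - a) * eta)) = p ^- 2.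
  by rewrite /p -exprVn -expRN -expRM_natl; congr expR; ring.
have -> : expR (- (2 * (H - h0) * eta)) = l ^- 2.
  by rewrite /l -exprVn -expRN -expRM_natl; congr expR; ring.
(* Everything is now a rational identity in p, q and l. *)
rewrite /sinh /cosh !expRN -/p -/q -/l.
field.
have l2 : l ^+ 2 - 1 != 0.
  by rewrite gt_eqF// subr_gt0 exprn_egt1.
by rewrite l2 (gt_eqF l0) (gt_eqF p0) (gt_eqF q0) (gt_eqF eta0).
Qed.

Lemma layer_factor_cvg1 {R : realType} (H h0 a b : R) (X : nat -> R) :
  (forall n, 0 < X n) -> X n @[n --> \oo] --> +oo ->
  h0 < H -> a < b -> b <= H ->
  layer_factor H h0 a b (X n) @[n --> \oo] --> (1 : R).
Proof.
move=> X0 Xy hH ab bH.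
have r1 : 0 < 4 * (H - a) by lra.
have r2 : 0 < 2 * (b - a) by lra.
have r3 : 0 < 2 * (H - a + (H - b)) by lra.
have r4 : 0 < 2 * (H - a) by lra.
have r5 : 0 < 2 * (H - h0) by lra.
have l1 := expN_cvg0 X0 Xy r1; have l2 := expN_cvg0 X0 Xy r2.
have l3 := expN_cvg0 X0 Xy r3; have l4 := mulexpN_cvg0 X0 Xy r4.
have l5 := expN_cvg0 X0 Xy r5.
have num := seq_cvgB (seq_cvgD (seq_cvgB (seq_cvgB (@seq_cvg_cst R 1) l1) l2) l3) (seq_cvgM (@seq_cvg_cst R (4 * (b - a))) l4).
have den := seq_cvgB (@seq_cvg_cst R 1) l5.
have den2 := seq_cvgM den den.
have nz : (1 - 0) * (1 - 0) != 0 :> R by rewrite subr0 mulr1 oner_eq0.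
have := seq_cvgM num (seq_cvgV nz den2).
rewrite !subr0 !mulr0 !addr0 !subr0 !mulr1 invr1 ?mulr1.
by move=> h; rewrite /layer_factor; under eq_fun do rewrite expr2; exact: h.
Qed.

(** * Asymptotics of the ratio *)

Section cross_section.
Context {R : realType} (omega1 : set R).
Hypothesis omega1_open : open omega1.
Hypothesis omega1_neq0 : omega1 !=set0.
Hypothesis omega1_sub : omega1 `<=` `]0, 1[%classic.

Let mo : measurable omega1. Proof. exact: open_measurable. Qed.

Let io (f : R -> R) : continuous f -> mu.-integrable omega1 (EFin \o f).
Proof.
move=> cf; have := continuous_integrable_itv 0 1 cf; apply: integrableS => //.
by apply: subset_trans omega1_sub _; exact: subset_itv_oo_cc.
Qed.

Lemma volE : vol omega1 = \int[mu]_(x in omega1) 1.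
Proof. by rewrite Rintegral_cst// mul1r. Qed.

Lemma vol_gt0 : 0 < vol omega1.
Proof.
have [p [q [pq pqo]]] := open_itv_sub omega1_open omega1_neq0.
rewrite volE; apply: (@lt_le_trans _ _ (\int[mu]_(x in `[p, q]) 1)).
  by rewrite Rintegral_cst_itv ?mul1r ?subr_gt0// ltW.
by apply: Rintegral_subset => //; apply: io; exact: cst_continuous.
Qed.

Lemma cross_sectionE (k : nat) :
  2 * \int[mu]_(x in omega1) (sin (k%:R * pi * x) ^+ 2) =
  vol omega1 - \int[mu]_(x in omega1) cos (2 * (k%:R * pi) * x).
Proof.
rewrite volE -RintegralB//; [|by apply: io; exact: cst_continuous|by apply: io; continuity].
rewrite -RintegralZl//; last by apply: io; continuity.
apply: eq_Rintegral => x _.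
have -> : 2 * (k%:R * pi) * x = (k%:R * pi * x) *+ 2 by rewrite -[RHS]mulr_natl; ring.
by rewrite cos_mulr2n cos2sin2 -[X in 1 - (X - 1)]mulr_natl; ring.
Qed.

(** 2 sin^2 y = 1 - cos (2 y), and the cosine part tends to 0. *)
Lemma cross_section_cvg (k : nat -> nat) :
  (forall n, (0 < k n)%N) -> (k n)%:R @[n --> \oo] --> (+oo : set_system R) ->
  2 * \int[mu]_(x in omega1) (sin ((k n)%:R * pi * x) ^+ 2) / vol omega1
    @[n --> \oo] --> (1 : R).
Proof.
move=> k0 ky.
have kN : (k n).-1 @[n --> \oo] --> \oo.
  apply/cvgnyPge => N.
  have ev : \forall n \near \oo, N.+1%:R <= (k n)%:R :> R.
    by move/cvgryPge : ky => /(_ N.+1%:R).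
  near=> n; have : N.+1%:R <= (k n)%:R :> R by near: n; exact: ev.
  by rewrite ler_nat; case: (k n) (k0 n).
have c0 := cvg_comp _ _ kN (cos_coefficient_cvg0 mo omega1_sub).
have v0 : vol omega1 != 0 by rewrite gt_eqF// vol_gt0.
have := seq_cvgM (seq_cvgB (@seq_cvg_cst R (vol omega1)) c0) (@seq_cvg_cst R (vol omega1)^-1).
rewrite subr0 divff// => h.
under eq_fun do rewrite cross_sectionE -[k _]prednK//.
exact: h.
Unshelve. all: by end_near. Qed.

End cross_section.

Section asymptotics.
Context {R : realType} (H h0 : R).
Hypothesis h0H : 0 < h0 < H.

(** The integral of sin^2 (xi x) over (0, h0), divided by its mean value h0/2. *)
Definition oscillation (xi : R) : R :=
  1 - sin (2 * (xi * h0)) / (2 * (xi * h0)).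

Lemma oscillation_ge (xi : R) : 1 < xi * h0 -> 2^-1 <= oscillation xi.
Proof.
move=> x1; have x0 : 0 < xi * h0 by exact: lt_trans x1.
have : sin (2 * (xi * h0)) / (2 * (xi * h0)) <= 2^-1.
  have y0 : 0 < 2 * (xi * h0) by rewrite mulr_gt0.
  rewrite (ler_pdivrMr _ _ y0) mulKf//.
  by rewrite (le_trans (sin_le1 _))// ltW.
by rewrite /oscillation; set y := _ / _; lra.
Qed.

Lemma lower_layerE (xi : R) : 0 < xi ->
  \int[mu]_(x in `[0, h0]) (sin (xi * x) ^+ 2) = h0 / 2 * oscillation xi.
Proof.
move=> xi0; have /andP[h00 _] := h0H.
rewrite Rintegral_sin2 ?(ltW h00) ?gt_eqF// mulr0 sin0 mul0r !subr0 /oscillation.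
rewrite [2 * (xi * h0)]mulr_natl sin_mulr2n -mulr_natl [cos _ * _]mulrC -mulr_natl.
by field; rewrite !gt_eqF.
Qed.

Lemma upper_layerE (a b xi eta : R) (W : R -> R) :
  guided_profile H h0 xi eta W -> h0 <= a -> a <= b -> b <= H -> 0 < eta ->
  \int[mu]_(x in `[a, b]) (W x ^+ 2) = sin (xi * h0) ^+ 2 *
    (expR (- (2 * (a - h0) * eta)) / (2 * eta) * layer_factor H h0 a b eta).
Proof.
move=> [cW _ W1] ha ab bH eta0; have /andP[h00 hH] := h0H.
rewrite -layer_integral_exp// -Rintegral_itvZ; last first.
  apply: continuous_funX; under eq_fun do rewrite mulrC.
  apply: continuous_funM; first exact: cst_continuous.
  apply: (@continuous_fun_comp _ _ (fun x => eta * (H - x)) sinh); first exact: sinh_continuous.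
  by continuity.
apply: eq_Rintegral_itv => x /andP[ax xb].
rewrite W1; last by rewrite (le_trans ha ax) (le_trans xb bH).
have s0 : 0 < sinh (eta * (H - h0)) by rewrite sinh_gt0// mulr_gt0// subr_gt0.
by field; rewrite gt_eqF.
Qed.

(** The mass of the profile in the upper layer relative to the lower one. *)
Definition correction (xi eta : R) : R :=
  sin (xi * h0) ^+ 2 * (layer_factor H h0 h0 H eta / (2 * eta)) /
    (h0 / 2 * oscillation xi).

(** The mass in the upper layer is O(1/eta), while the lower layer carries at
    least h0/4: the correction is negligible when eta tends to infinity. *)
Lemma profile_ratio (a b xi eta : R) (W : R -> R) :
  guided_profile H h0 xi eta W -> dispersion H h0 xi eta -> 0 < xi -> 0 < eta ->
  h0 <= a -> a < b -> b <= H ->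
  \int[mu]_(x in `[a, b]) (W x ^+ 2) / \int[mu]_(x in `[0, H]) (W x ^+ 2) =
  h0^-1 * (sin (xi * h0) ^+ 2 / oscillation xi) * (expR (- 2 * eta * (a - h0)) / eta) *
  (layer_factor H h0 a b eta / (1 + correction xi eta)) /\
  0 <= correction xi eta <= (2 / h0) * (layer_factor H h0 h0 H eta / eta).
Proof.
move=> gW disp xi0 eta0 ha ab bH; have /andP[h00 hH] := h0H.
have D0 := profile_sqr_gt0 h0H xi0 gW.
have osc := oscillation_ge (dispersion_phase h0H xi0 eta0 disp).
have [cW W0 _] := gW.
have osc0 : 0 < oscillation xi by lra.
have DE : \int[mu]_(x in `[0, H]) (W x ^+ 2) =
    h0 / 2 * oscillation xi * (1 + correction xi eta).
  rewrite (@Rintegral_itv_split _ 0 h0 H) ?(ltW h00) ?(ltW hH)//; last by continuity.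
  rewrite (upper_layerE gW (lexx h0) (ltW hH) (lexx H) eta0).
  rewrite subrr mulr0 mul0r oppr0 expR0.
  have -> : \int[mu]_(x in `[0, h0]) (W x ^+ 2) = h0 / 2 * oscillation xi.
    by rewrite -lower_layerE//; apply: eq_Rintegral_itv => x /W0 ->.
  rewrite /correction; field.
  by rewrite (gt_eqF eta0) (gt_eqF osc0) (gt_eqF h00).
have T0 : 0 <= layer_factor H h0 h0 H eta.
  have := layer_integral_exp hH (ltW hH) eta0.
  rewrite subrr mulr0 mul0r oppr0 expR0 => E.
  have : 0 <= 1 / (2 * eta) * layer_factor H h0 h0 H eta.
    by rewrite -E; apply: Rintegral_ge0 => x _; exact: sqr_ge0.
  by rewrite pmulr_rge0// divr_gt0// mulr_gt0.
have sin2 : sin (xi * h0) ^+ 2 <= 1 by rewrite sin2cos2 gerBl sqr_ge0.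
have cor0 : 0 <= correction xi eta.
  have e0 : 0 <= 2 * eta by rewrite mulr_ge0// ltW.
  have d0 : 0 <= h0 / 2 * oscillation xi by rewrite mulr_ge0 ?divr_ge0// ltW.
  by rewrite /correction divr_ge0// mulr_ge0 ?sqr_ge0// divr_ge0.
split.
  rewrite DE (upper_layerE gW ha (ltW ab) bH eta0).
  have -> : - (2 * (a - h0) * eta) = - 2 * eta * (a - h0) by ring.
  field.
  by rewrite !gt_eqF// ltr_pwDl.
rewrite cor0 /=.
rewrite /correction ler_pdivrMr ?mulr_gt0 ?divr_gt0//.
apply: (@le_trans _ _ (layer_factor H h0 h0 H eta / (2 * eta))).
  by rewrite ler_piMl// divr_ge0// mulr_ge0// ltW.
have -> : 2 / h0 * (layer_factor H h0 h0 H eta / eta) * (h0 / 2 * oscillation xi) =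
    (layer_factor H h0 h0 H eta / (2 * eta)) * (2 * oscillation xi).
  by field; rewrite !gt_eqF.
have T1 : 0 <= layer_factor H h0 h0 H eta / (2 * eta).
  by rewrite divr_ge0// mulr_ge0// ltW.
by rewrite ler_peMr//; lra.
Qed.

End asymptotics.

(** * Guided sequences *)

Lemma guided_parameters {R : realType} (c1 lambda : R) (k : nat) :
  1 < c1 -> guided c1 k lambda ->
  [/\ 0 < xi0_of k lambda, 0 < xi1'_of c1 k lambda,
      lambda - k%:R ^+ 2 * pi ^+ 2 = xi0_of k lambda ^+ 2,
      lambda / c1 - k%:R ^+ 2 * pi ^+ 2 = - xi1'_of c1 k lambda ^+ 2 &
      xi1'_of c1 k lambda <= k%:R * pi].
Proof.
move=> c11 /andP[l1 l2]; have c10 : 0 < c1 by exact: lt_trans c11.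
have l3 : lambda / c1 < k%:R ^+ 2 * pi ^+ 2 by rewrite ltr_pdivrMr// mulrC.
have d0 : 0 < lambda - k%:R ^+ 2 * pi ^+ 2 by rewrite subr_gt0.
have d1 : 0 < k%:R ^+ 2 * pi ^+ 2 - lambda / c1 by rewrite subr_gt0.
have kpi : 0 <= k%:R * pi :> R by rewrite mulr_ge0// pi_ge0.
split.
- by rewrite /xi0_of sqrtr_gt0.
- by rewrite /xi1'_of sqrtr_gt0.
- by rewrite /xi0_of sqr_sqrtr// ltW.
- by rewrite /xi1'_of sqr_sqrtr ?opprB// ltW.
- rewrite /xi1'_of -[leRHS]ger0_norm// -sqrtr_sqr ler_wsqrtr// exprMn gerBl.
  rewrite divr_ge0 ?(ltW c10)//; apply: (le_trans _ (ltW l1)).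
  by rewrite mulr_ge0 ?sqr_ge0.
Qed.

Lemma equiv_of_ratio_cvg {R : realType} (f g t : nat -> R) :
  (forall n, f n = g n * t n) -> t n @[n --> \oo] --> (1 : R) -> f ~_\oo g.
Proof.
move=> fgt t1; apply/eqaddoP => eps eps0.
have ev : \forall n \near \oo, `|1 - t n| <= eps by exact: (cvgr_dist_le _ _ t1).
near=> n.
have -> : (f - g) n = g n * - (1 - t n).
  by rewrite (_ : (f - g) n = f n - g n)// fgt; ring.
by rewrite normrM normrN mulrC ler_wpM2r//; near: n; exact: ev.
Unshelve. all: by end_near. Qed.

Unset Implicit Arguments.

Theorem mainTheorem4 (R : realType) (H h0 c1 : R)
  (hH : 0 < H) (hh0 : 0 < h0 < H) (hc1 : 1 < c1)
  (omega1 : set R) (a b : R)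
  (omega1_open : open omega1) (omega1_neq0 : omega1 !=set0)
  (omega1_sub : omega1 `<=` `]0, 1[%classic)
  (hab : 0 <= a < b) (hb : b <= H)
  (lambda : nat -> nat -> R) (u : nat -> nat -> R -> R) (alpha : nat -> nat -> R)
  (hlambda : eigenvalue_enumeration H h0 c1 lambda)
  (hu : forall k l : nat, (0 < k)%N -> (0 < l)%N ->
          mode H h0 c1 k (lambda k l) (u k l))
  (halpha : forall k l : nat, (0 < k)%N -> (0 < l)%N -> alpha k l != 0)
  (k l : nat -> nat)
  (hk : forall n, (0 < k n)%N) (hl : forall n, (0 < l n)%N)
  (kl_inj : injective (fun n => (k n, l n)))
  (kl_guided : forall n, guided c1 (k n) (lambda (k n) (l n))) :
  let Omega := strip 0 H in
  let Omega0 := strip 0 h0 in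
  let Omega1 := strip h0 H in
  let omega := omega1 `*` `]a, b[%classic in
  let v := fun n => eigenfunction (alpha (k n) (l n)) (k n) (u (k n) (l n)) in
  let xi0 := fun n => xi0_of (k n) (lambda (k n) (l n)) in
  let xi1' := fun n => xi1'_of c1 (k n) (lambda (k n) (l n)) in
  let ratio := fun n => L2norm omega (v n) ^+ 2 / L2norm Omega (v n) ^+ 2 in
  (omega `<=` Omega1 ->
    (xi1' n @[n --> \oo] --> +oo ->
      ratio ~_\oo (fun n =>
        vol omega1 / h0
        * (sin (xi0 n * h0) ^+ 2
           / (1 - sin (2 * (xi0 n * h0)) / (2 * (xi0 n * h0))))
        * (expR (- 2 * xi1' n * (a - h0)) / xi1' n)))
    /\
    ((ereal_sup (range (fun n => (xi1' n)%:E)) < +oo)%E ->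
      0 < inf (range ratio)))
  /\
  (omega `<=` Omega0 -> 0 < inf (range ratio)).
Proof.
move=> Omega Omega0 Omega1 omega v xi0 xi1' ratio.
have /andP[h00 hH'] := hh0; have /andP[a0 ab] := hab.
have mo : measurable omega1 by exact: open_measurable.
have par n := guided_parameters hc1 (kl_guided n).
have xi_gt0 n : 0 < xi0 n by have [] := par n.
have eta_gt0 n : 0 < xi1' n by have [] := par n.
have formula n : dispersion H h0 (xi0 n) (xi1' n) /\
    exists2 W : R -> R, guided_profile H h0 (xi0 n) (xi1' n) W &
      ratio n = 2 * \int[lebesgue_measure]_(x in omega1) (sin ((k n)%:R * pi * x) ^+ 2) *
        (\int[lebesgue_measure]_(x in `[a, b]) (W x ^+ 2) /
         \int[lebesgue_measure]_(x in `[0, H]) (W x ^+ 2)).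
  have [p1 p2 p3 p4 _] := par n.
  have := ratio_eq hh0 mo omega1_sub hab hb (halpha _ _ (hk n) (hl n)) (hk n)
    (hu _ _ (hk n) (hl n)) p1 p2 p3 p4.
  case=> disp [W gW E]; split=> //; exists W => //; exact: E.
have [d1 d1_gt0 d1P] := cross_section_lb omega1_open omega1_neq0 omega1_sub.
have bounded_below d2 : 0 < d2 ->
    (forall n W, dispersion H h0 (xi0 n) (xi1' n) ->
      guided_profile H h0 (xi0 n) (xi1' n) W ->
      d2 <= \int[lebesgue_measure]_(x in `[a, b]) (W x ^+ 2)) ->
    0 < inf (range ratio).
  move=> d2_gt0 d2P; apply: (@inf_range_gt0 _ _ (2 * d1 * (d2 / H))).
    by rewrite !mulr_gt0// invr_gt0.
  move=> n; have [disp [W gW ->]] := formula n.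
  apply: ler_pM; [by rewrite mulr_ge0// ltW|by rewrite divr_ge0// ltW| |].
    by rewrite ler_pM2l// d1P.
  apply: ler_pM; [exact: ltW|by rewrite invr_ge0 ltW|exact: d2P disp gW|].
  rewrite lef_pV2 ?posrE//; last exact: (profile_sqr_gt0 hh0 (xi_gt0 n) gW).
  exact: (profile_sqr_le hh0 (eta_gt0 n) gW).
have [x1 omega1x] := omega1_neq0.
have mid_omega y : a < y < b -> omega (x1, y).
  by move=> ayb; split => //=; rewrite in_itv.
(* Otherwise the window would meet the lower layer. *)
have above : omega `<=` Omega1 -> h0 <= a.
  move=> sub; rewrite leNgt; apply/negP => ah.
  pose y := (a + Num.min b h0) / 2.
  have am : a < Num.min b h0 by rewrite lt_min ab ah.
  have [m1 m2] : Num.min b h0 <= b /\ Num.min b h0 <= h0.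
    by split; rewrite ge_min lexx ?orbT.
  have : a < y < b by apply/andP; split; rewrite /y; lra.
  move=> /mid_omega/sub; rewrite /Omega1 /strip /= !in_itv/= /y => -[_ /andP[h _]].
  by lra.
split; [move=> sub; split|].
- have ha := above sub.
  move=> etay.
  (* Since eta <= k pi, the wave numbers tend to infinity with eta. *)
  have ky : (k n)%:R @[n --> \oo] --> (+oo : set_system R).
    apply/cvgryPge => A; have /cvgryPge/(_ (A * pi)) ev := etay.
    near=> n; have : A * pi <= xi1' n by near: n; exact: ev.
    have [_ _ _ _ le_kpi] := par n => /le_trans/(_ le_kpi).
    by rewrite ler_pM2r// pi_gt0.
  have l0 := cross_section_cvg omega1_open omega1_neq0 omega1_sub hk ky.
  have l1 := layer_factor_cvg1 eta_gt0 etay hH' ab hb.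
  have l2 := layer_factor_cvg1 eta_gt0 etay hH' hH' (lexx H).
  have l3 : (2 / h0) * (layer_factor H h0 h0 H (xi1' n) / xi1' n) @[n --> \oo] --> (0 : R).
    have := seq_cvgM (@seq_cvg_cst R (2 / h0)) (seq_cvgM l2 (inv_seq_cvg0 eta_gt0 etay)).
    by rewrite !mulr0.
  have cor_bnd n : 0 <= correction H h0 (xi0 n) (xi1' n) <=
      (2 / h0) * (layer_factor H h0 h0 H (xi1' n) / xi1' n).
    have [disp [W gW _]] := formula n.
    by have [] := profile_ratio hh0 gW disp (xi_gt0 n) (eta_gt0 n) ha ab hb.
  have l4 : correction H h0 (xi0 n) (xi1' n) @[n --> \oo] --> (0 : R).
    by apply: squeeze_cvgr (@seq_cvg_cst R 0) l3; exact: nearW.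
  pose t n := 2 * \int[lebesgue_measure]_(x in omega1) (sin ((k n)%:R * pi * x) ^+ 2)
    / vol omega1 *
    (layer_factor H h0 a b (xi1' n) / (1 + correction H h0 (xi0 n) (xi1' n))).
  apply: (@equiv_of_ratio_cvg _ _ _ t); last first.
    have := seq_cvgD (@seq_cvg_cst R 1) l4; rewrite addr0 => l5.
    have := seq_cvgM l0 (seq_cvgM l1 (seq_cvgV (oner_neq0 R) l5)).
    by rewrite invr1 !mulr1.
  move=> n; have [disp [W gW ->]] := formula n.
  have [-> _] := profile_ratio hh0 gW disp (xi_gt0 n) (eta_gt0 n) ha ab hb.
  have v0 := vol_gt0 omega1_open omega1_neq0 omega1_sub.
  rewrite /t -/(oscillation h0 (xi0 n)); set I1 := Rintegral _ _ _.
  set o := oscillation _ _; set T := layer_factor _ _ _ _ _ / _.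
  set E := expR _ / _; set S := sin _ ^+ 2 / _.
  by field; rewrite (gt_eqF v0) (gt_eqF h00).
- move=> bnd.
  have [M etaM] : exists M, forall n, xi1' n <= M.
    have ub n : ((xi1' n)%:E <= ereal_sup (range (fun n => (xi1' n)%:E)))%E.
      by apply: ereal_sup_ubound; exists n.
    case: (ereal_sup _) bnd ub => [M _ ub|//|_ ub].
      by exists M => n; rewrite -lee_fin.
    by have := ub 0%N.
  have ha := above sub.
  have [d2 d2_gt0 d2P] := upper_layer_lb M hh0 ha ab hb.
  by apply: (bounded_below d2) => // n W disp gW; exact: d2P disp gW.
- move=> sub.
  (* Otherwise the window would meet the upper layer. *)
  have hbh : b <= h0.
    rewrite leNgt; apply/negP => bh.
    pose y := (b + Num.max a h0) / 2.
    have am : Num.max a h0 < b by rewrite gt_max ab bh.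
    have [m1 m2] : a <= Num.max a h0 /\ h0 <= Num.max a h0.
      by split; rewrite le_max lexx ?orbT.
    have : a < y < b by apply/andP; split; rewrite /y; lra.
    move=> /mid_omega/sub; rewrite /Omega0 /strip /= !in_itv/= /y => -[_ /andP[_ h]].
    by lra.
  have [d2 d2_gt0 d2P] := lower_layer_lb hh0 a0 ab hbh.
  by apply: (bounded_below d2) => // n W disp gW; exact: d2P disp gW.
Unshelve. all: by end_near. Qed.
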